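(* Let $G$ be a Lie group with Lie algebra $\mathfrak{g}$, let $\xi\in\mathfrak{g}$, and define $c(t)=t\xi$. Then parallel transport along $c$ with respect to the natural connection on $\mathfrak{g}\times G$ is given by $g(t)=\exp(t\xi)$.
   Context: $\mathfrak{g}=T_1G$, and $R_g:G\to G$, $h\mapsto hg$. The trivial right principal $G$-bundle over $\mathfrak{g}$ is $P=\mathfrak{g}\times G$ with projection $(x,g)\mapsto x$ and action $(x,h)\cdot g=(x,hg)$. The natural connection on $P$ is the connection whose horizontal space at $(x,g)$ is $H_{(x,g)}=\{(v,T_1R_g(v))\mid v\in\mathfrak{g}\}\subset\mathfrak{g}\times T_gG$. Given a smooth curve $c:[0,1]\to\mathfrak{g}$, parallel transport along $c$ is the horizontal lift $(c(t),g(t))$ with initial condition $g(0)=1$, i.e. $g$ is the solution of the differential equation $g'(t)=T_1R_{g(t)}(c'(t))$ with $g(0)=1$. *)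

(* Defs.v *)
From HB Require Import structures.
From mathcomp Require Import all_boot all_order all_algebra.
From mathcomp Require Import all_classical all_reals all_analysis.

Set Implicit Arguments.
Unset Strict Implicit.
Unset Printing Implicit Defensive.

Import Order.TTheory GRing.Theory Num.Theory.
Import numFieldNormedType.Exports.

Local Open Scope classical_set_scope.
Local Open Scope ring_scope.

(* C^k on an open set of a finite-dimensional space; only the germs of [f] at *)
(* the points of [U] matter.                                                  *)
Fixpoint Ck (R : realType) (V W : normedModType R) (k : nat) (U : set V)
    (f : V -> W) : Prop :=
  match k with
  | 0 => {in U, continuous f}
  | k'.+1 => {in U, forall x, differentiable f x} /\
             forall v : V, Ck k' U (fun x => 'D_v f x)
  end.

Definition smooth_on (R : realType) (V W : normedModType R) (U : set V)
    (f : V -> W) : Prop :=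
  forall k, Ck k U f.

(* A homeomorphism from an open set of [M] onto an open set of R^n; the two   *)
(* total functions take irrelevant values outside these sets.                 *)
Record chart (R : realType) (n : nat) (M : topologicalType) := Chart {
  chart_dom : set M;
  chart_cod : set 'rV[R]_n;
  chart_fun :> M -> 'rV[R]_n;
  chart_inv : 'rV[R]_n -> M;
  chart_dom_open : open chart_dom;
  chart_cod_open : open chart_cod;
  chart_funS : set_fun chart_dom chart_cod chart_fun;
  chart_invS : set_fun chart_cod chart_dom chart_inv;
  chart_funK : {in chart_dom, cancel chart_fun chart_inv};
  chart_invK : {in chart_cod, cancel chart_inv chart_fun};
  chart_fun_continuous : {in chart_dom, continuous chart_fun};
  chart_inv_continuous : {in chart_cod, continuous chart_inv} }.

(* The atlas need not be maximal.                                             *)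
HB.mixin Record isManifold (R : realType) (n : nat) M & Topological M := {
  atlas : set (chart R n M);
  atlas_cover : forall x : M, exists2 phi, atlas phi & chart_dom phi x;
  atlas_compatible : forall phi psi, atlas phi -> atlas psi ->
    smooth_on [set u | chart_cod phi u /\ chart_dom psi (chart_inv phi u)]
      (psi \o chart_inv phi);
  manifold_hausdorff : hausdorff_space M;
  manifold_second_countable : @second_countable M }.

#[short(type="manifoldType")]
HB.structure Definition Manifold (R : realType) (n : nat) :=
  {M of isManifold R n M & Topological M}.

Arguments atlas {R n s}.

Definition chart_at (R : realType) (n : nat) (M : manifoldType R n) (x : M)
    (phi : chart R n M) : Prop :=
  atlas phi /\ chart_dom phi x.

Definition smooth_map (R : realType) (m n : nat) (M : manifoldType R m)
    (N : manifoldType R n) (f : M -> N) : Prop :=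
  continuous f /\
  forall phi psi, atlas phi -> atlas psi ->
    smooth_on [set u | chart_cod phi u /\ chart_dom psi (f (chart_inv phi u))]
      (psi \o f \o chart_inv phi).

(* Smoothness of the multiplication is stated in the charts [phi1 x phi2] of  *)
(* the product manifold [G * G].                                              *)
HB.mixin Record isLieGroup (R : realType) (n : nat) G
    & Manifold R n G & Group G := {
  mulg_continuous : continuous (fun p : G * G => (p.1 * p.2)%g);
  mulg_smooth : forall phi1 phi2 psi : chart R n G,
    atlas phi1 -> atlas phi2 -> atlas psi ->
    smooth_on
      [set u : 'rV[R]_n * 'rV[R]_n |
        [/\ chart_cod phi1 u.1, chart_cod phi2 u.2 &
            chart_dom psi (chart_inv phi1 u.1 * chart_inv phi2 u.2)%g]]
      (fun u => psi (chart_inv phi1 u.1 * chart_inv phi2 u.2)%g);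
  invg_smooth : smooth_map (fun g : G => g^-1)%g }.

#[short(type="lieGroupType")]
HB.structure Definition LieGroup (R : realType) (n : nat) :=
  {G of isLieGroup R n G & Manifold R n G & Group G}.

(* A tangent vector at [x] is the family of its coordinate vectors in all the *)
(* charts at [x], related by the differentials of the changes of charts.      *)
(* Requiring 0 at the other charts makes the representation unique.           *)
Section tangent_space.
Context {R : realType} {n : nat} {M : manifoldType R n} (x : M).

Definition tangent_pred : {pred chart R n M -> 'rV[R]_n} := fun v =>
  `[< (forall phi, ~ chart_at x phi -> v phi = 0) /\
      (forall phi psi, chart_at x phi -> chart_at x psi ->
         v psi = 'd (psi \o chart_inv phi) (phi x) (v phi)) >].

Fact tangent_pred_submod : submod_closed tangent_pred.
Proof.
split; first by apply/asboolP; split => // phi psi _ _; rewrite linear0.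
move=> a u v /asboolP[u0 uP] /asboolP[v0 vP]; apply/asboolP; split.
  by move=> phi xphi; rewrite !fctE u0 // v0 // scaler0 addr0.
move=> phi psi xphi xpsi.
by rewrite !fctE linearP (uP phi) // (vP phi).
Qed.

HB.instance Definition _ := GRing.isSubmodClosed.Build R
  (chart R n M -> 'rV[R]_n) tangent_pred tangent_pred_submod.

Record tangent := Tangent {
  tcoord :> chart R n M -> 'rV[R]_n;
  _ : tcoord \in tangent_pred }.

HB.instance Definition _ := [isSub for tcoord].
HB.instance Definition _ := [Choice of tangent by <:].
HB.instance Definition _ := [SubChoice_isSubLmodule of tangent by <:].

End tangent_space.

Arguments tangent {R n M} x.

(* T_x f v; for a smooth [f] such a vector exists, see [tmapE], and it is      *)
(* unique since its coordinates in all the charts at [f x] are prescribed.    *)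
Definition tmap (R : realType) (m n : nat) (M : manifoldType R m)
    (N : manifoldType R n) (f : M -> N) (x : M) (v : tangent x) :
    tangent (f x) :=
  xget 0 [set w : tangent (f x) | forall phi psi,
    chart_at x phi -> chart_at (f x) psi ->
    w psi = 'd (psi \o f \o chart_inv phi) (phi x) (v phi)].

Lemma near_eq_diff (R : realType) (V W : normedModType R) (f g : V -> W)
    (x : V) : {near x, f =1 g} -> differentiable f x ->
  differentiable g x /\ 'd g x = 'd f x :> (V -> W).
Proof.
move=> fg df; have fgx : f x = g x := nbhs_singleton fg.
have dfc : continuous ('d f x) by case/diff_locallyP: df.
have fgE : g \o shift x = cst (g x) + 'd f x +o_ 0 id.
  have /eqaddoP fo := diff_locally df.
  apply/eqaddoP => e /fo {}fo; move: fg; rewrite (near_shift 0) subr0 => fg.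
  near=> y; rewrite /= -fgx.
  have -> : (g \o shift x - (cst (f x) + 'd f x)) y =
            (f \o shift x - (cst (f x) + 'd f x)) y.
    by rewrite !fctE; congr (_ - _); rewrite /= -(near fg y).
  by near: y.
have dgE := diff_unique dfc fgE.
by split=> //; apply/diff_locallyP; rewrite dgE.
Unshelve. all: by end_near. Qed.

Lemma tmapE (R : realType) (m n : nat) (M : manifoldType R m)
    (N : manifoldType R n) (f : M -> N) (x : M) (v : tangent x) :
  smooth_map f ->
  forall phi psi, chart_at x phi -> chart_at (f x) psi ->
  tmap f v psi = 'd (psi \o f \o chart_inv phi) (phi x) (v phi).
Proof.
move=> [fc fs].
have near_inv k (K : manifoldType R k) (y : K) (phi : chart R k K)
    (A : set K) : chart_at y phi -> nbhs y A ->
    \forall u \near phi y, A (chart_inv phi u).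
  move=> [aphi ydom] yA.
  have /(chart_inv_continuous (c := phi)) : phi y \in chart_cod phi.
    by rewrite inE; exact: chart_funS.
  by rewrite /continuous_at chart_funK ?inE//; apply.
have dchange k (K : manifoldType R k) (y : K) (phi psi : chart R k K) :
    chart_at y phi -> chart_at y psi ->
    differentiable (psi \o chart_inv phi) (phi y).
  move=> [aphi yphi] [apsi ypsi].
  have [+ _] := atlas_compatible _ _ aphi apsi 1%N.
  apply; rewrite inE/= chart_funK ?inE//; split => //; exact: chart_funS.
have df phi psi : chart_at x phi -> chart_at (f x) psi ->
    differentiable (psi \o f \o chart_inv phi) (phi x).
  move=> [aphi yphi] [apsi ypsi].
  have [+ _] := fs _ _ aphi apsi 1%N.
  apply; rewrite inE/= chart_funK ?inE//; split => //; exact: chart_funS.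
have vP phi psi : chart_at x phi -> chart_at x psi ->
    v psi = 'd (psi \o chart_inv phi) (phi x) (v phi).
  by case: v => v /= /asboolP[_]; apply.
have key phi phi' psi psi' : chart_at x phi -> chart_at x phi' ->
    chart_at (f x) psi -> chart_at (f x) psi' ->
    'd (psi' \o f \o chart_inv phi') (phi' x) (v phi') =
    'd (psi' \o chart_inv psi) (psi (f x))
      ('d (psi \o f \o chart_inv phi) (phi x) (v phi)).
  move=> xphi xphi' fpsi fpsi'.
  rewrite (vP phi phi')//.
  pose a := phi' \o chart_inv phi; pose b := psi' \o f \o chart_inv phi'.
  pose c := psi \o f \o chart_inv phi; pose d := psi' \o chart_inv psi.
  have ax : a (phi x) = phi' x.
    by rewrite /a/= chart_funK ?inE//; case: xphi.
  have cx : c (phi x) = psi (f x).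
    by rewrite /c/= chart_funK ?inE//; case: xphi.
  have da : differentiable a (phi x) by exact: dchange.
  have db : differentiable b (a (phi x)) by rewrite ax; exact: df.
  have dc : differentiable c (phi x) by exact: df.
  have dd : differentiable d (c (phi x)) by rewrite cx; exact: dchange.
  have ba_dc : {near phi x, b \o a =1 d \o c}.
    have N1 : nbhs x (chart_dom phi').
      by apply: open_nbhs_nbhs; split; [exact: chart_dom_open|case: xphi'].
    have N2 : nbhs x (f @^-1` chart_dom psi).
      apply: (fc x); apply: open_nbhs_nbhs.
      by split; [exact: chart_dom_open|case: fpsi].
    have N12 : nbhs x (chart_dom phi' `&` f @^-1` chart_dom psi).
      exact: filterI.
    have := near_inv _ _ _ _ _ xphi N12; apply: filterS => u [u1 u2].
    by rewrite /a /b /c /d/= (chart_funK (c := phi')) ?inE// (chart_funK (c := psi)) ?inE.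
  have [_ dE] := near_eq_diff ba_dc (differentiable_comp da db).
  have : ('d d (c (phi x)) \o 'd c (phi x)) (v phi) =
         ('d b (a (phi x)) \o 'd a (phi x)) (v phi).
    have E1 := congr1 (@^~ (v phi)) (diff_comp dc dd).
    have E2 := congr1 (@^~ (v phi)) (diff_comp da db).
    exact: etrans (esym E1) (etrans (congr1 (@^~ (v phi)) dE) E2).
  by rewrite ax cx => /esym.
have [phi0 aphi0 xphi0] := atlas_cover x.
have x0 : chart_at x phi0 by split.
pose w (psi : chart R n N) : 'rV[R]_n :=
  if pselect (chart_at (f x) psi) then
    'd (psi \o f \o chart_inv phi0) (phi0 x) (v phi0) else 0.
have wE psi : chart_at (f x) psi ->
    w psi = 'd (psi \o f \o chart_inv phi0) (phi0 x) (v phi0).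
  by rewrite /w; case: pselect.
have wP : w \in tangent_pred (f x).
  apply/asboolP; split; first by move=> psi; rewrite /w; case: pselect.
  by move=> psi psi' h h'; rewrite !wE//; exact: key.
rewrite /tmap; case: xgetP => [_ -> //|/(_ (Tangent wP)) /= H].
exfalso; apply: H => phi psi xphi fpsi; rewrite wE//.
exact: etrans (key phi phi0 psi psi xphi x0 fpsi fpsi)
  (esym (key phi phi psi psi xphi xphi fpsi fpsi)).
Qed.
(* [gamma] has velocity [v] at [t] as a curve defined on [I]: the limits are  *)
(* one-sided at the endpoints of an interval [I]. Continuity forces           *)
(* [gamma (t + h)] to lie in the domain of the chart for small [h].           *)
Definition velocity_within (R : realType) (n : nat) (M : manifoldType R n)
    (I : set R) (gamma : R -> M) (t : R) (v : tangent (gamma t)) : Prop :=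
  gamma s @[s --> within I (nbhs t)] --> gamma t /\
  forall phi, chart_at (gamma t) phi ->
    h^-1 *: (phi (gamma (t + h)) - phi (gamma t))
      @[h --> within [set h | I (t + h)] 0^'] --> v phi.

Arguments velocity_within {R n M} I gamma t v.

(* The topology of [tangent x] is that of the coordinates in any chart.       *)
Definition derivative_within (R : realType) (n : nat) (M : manifoldType R n)
    (x : M) (I : set R) (c : R -> tangent x) (t : R) (v : tangent x) : Prop :=
  forall phi, chart_at x phi ->
    h^-1 *: (c (t + h) phi - c t phi)
      @[h --> within [set h | I (t + h)] 0^'] --> v phi.

Section parallel_transport.
Context {R : realType} {n : nat} {G : lieGroupType R n}.

Definition lie_algebra := tangent (1%g : G).

Definition translate_right (g h : G) : G := (h * g)%g.
Definition translate_left (g h : G) : G := (g * h)%g.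

(* T_1 R_g and T_1 L_g, with values in [tangent g] instead of                 *)
(* [tangent (1 * g)] and [tangent (g * 1)].                                   *)
Definition tmap_right (g : G) (v : lie_algebra) : tangent g :=
  ecast z (tangent z) (mul1g g) (tmap (translate_right g) v).
Definition tmap_left (g : G) (v : lie_algebra) : tangent g :=
  ecast z (tangent z) (mulg1 g) (tmap (translate_left g) v).

(* The value at time 1 of the integral curve, starting at the unit, of the    *)
(* left-invariant vector field generated by [xi]; the default value 1 is      *)
(* never taken since left-invariant fields are complete.                      *)
Definition lie_exp (xi : lie_algebra) : G :=
  xget 1%g [set g : G | exists gamma : R -> G,
    [/\ gamma 0 = 1%g,
        forall t, velocity_within setT gamma t (tmap_left (gamma t) xi) &
        gamma 1 = g]].

(* The total space of the trivial bundle over the Lie algebra; its tangent    *)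
(* space at [(x, g)] is [lie_algebra * tangent g].                            *)
Definition bundle := (lie_algebra * G)%type.

Definition natural_connection (p : bundle) : set (lie_algebra * tangent p.2) :=
  [set (v, tmap_right p.2 v) | v in setT].

Definition horizontal_lift
    (H : forall p : bundle, set (lie_algebra * tangent p.2))
    (c : R -> lie_algebra) (p : R -> bundle) : Prop :=
  forall t, `[0, 1]%classic t ->
    (p t).1 = c t /\
    exists u : lie_algebra * tangent (p t).2,
      [/\ derivative_within `[0, 1]%classic (fun s => (p s).1) t u.1,
          velocity_within `[0, 1]%classic (fun s => (p s).2) t u.2 &
          H (p t) u].

Definition parallel_transport
    (H : forall p : bundle, set (lie_algebra * tangent p.2))
    (c : R -> lie_algebra) (g : R -> G) : Prop :=
  horizontal_lift H c (fun t => (c t, g t)) /\ g 0 = 1%g.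

End parallel_transport.

Arguments lie_algebra {R n} G.
Arguments bundle {R n} G.

(* Main.v *)
Require Import Defs.
From mathcomp Require Import all_boot all_order all_algebra.
From mathcomp Require Import all_classical all_reals all_analysis.
From mathcomp Require Import ring lra.

Set Implicit Arguments.
Unset Strict Implicit.
Unset Printing Implicit Defensive.

Import Order.TTheory GRing.Theory Num.Theory.
Import numFieldNormedType.Exports.

Local Open Scope classical_set_scope.
Local Open Scope ring_scope.

(* If gamma' = T L_gamma xi and delta' = T R_delta xi, then the product       *)
(* gamma(t) delta(b - t) has velocity zero, so gamma(b) delta(0) =            *)
(* gamma(0) delta(b). Hence an integral curve of the left-invariant field and *)
(* one of the right-invariant field that both start at the unit agree: this   *)
(* is the uniqueness theorem for both differential equations. Applied to      *)
(* local solutions (Picard iteration in a chart) it also gives                *)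
(* gamma(s + t) = gamma(s) gamma(t) for small s and t, so gamma extends to a  *)
(* one-parameter subgroup. This solves both equations on the whole line, and  *)
(* is therefore t |-> exp(t xi) as well as the parallel transport.            *)

(** * Picard iteration *)

(** A horizontal lift of [t *: xi] is an integral curve of the right-invariant field of [xi],
    whereas [lie_exp] is defined through the left-invariant one. What joins them is associativity:
    left and right translations commute ([tmap_translateC]), so by the Leibniz rule
    ([has_velocity_mulg]) a left integral curve times a time-reversed right integral curve has
    velocity zero, and it is constant by [eq_of_velocity0]. The resulting identity,
    [left_right_integral], gives every uniqueness statement below. Existence comes from
    [picard_lipschitz], applied to both invariant fields in a chart at the unit. By
    [local_one_parameter] the left integral curve is multiplicative near 0. Taking powers of its
    values extends it to a homomorphism [Gamma] on the line ([one_parameter_extension]), which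
    solves both equations everywhere ([one_parameter_velocity]). Comparison with [Gamma] identifies
    [lie_exp (s *: xi)] in [lie_exp_one_parameter], and the parallel transport in [theorem7]. *)

Lemma mx_norm_coord (R : realType) (n : nat) (u : 'rV[R]_n) j :
  `|u 0 j| <= `|u|.
Proof.
rewrite [leRHS]/Num.Def.normr/= mx_normrE.
exact: (le_bigmax _ (fun ij => `|u ij.1 ij.2|) (0, j)).
Qed.

Lemma mx_norm_le (R : realType) (n : nat) (u : 'rV[R]_n) (M : R) :
  0 <= M -> (forall j, `|u 0 j| <= M) -> `|u| <= M.
Proof.
move=> M0 uM; rewrite [leLHS]/Num.Def.normr/= mx_normrE.
by apply: bigmax_le => // -[i j] _; rewrite (ord1 i).
Qed.

Lemma is_derive_coord (R : realType) (n : nat) (F : R -> 'rV[R]_n) (t : R)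
    (dF : 'rV[R]_n) j :
  is_derive t 1 F dF -> is_derive t 1 (fun s => F s 0 j) (dF 0 j).
Proof.
case=> dFt <-; have dj := (derivable_mxP F t 1).1 dFt 0 j.
by rewrite derive_mx// mxE; exact: derivableP.
Qed.

Lemma is_derive_rV (R : realType) (n : nat) (F : R -> 'rV[R]_n) (t : R)
    (dF : 'rV[R]_n) :
  (forall j, is_derive t 1 (fun s => F s 0 j) (dF 0 j)) -> is_derive t 1 F dF.
Proof.
move=> Fj; have dFt : derivable F t 1.
  by apply/derivable_mxP => i j; rewrite (ord1 i); case: (Fj j).
apply: DeriveDef => //; rewrite derive_mx//; apply/rowP => j.
by rewrite mxE; case: (Fj j).
Qed.

Lemma is_derive_continuous (R : realType) (V : normedModType R) (F : R -> V)
    (t : R) (v : V) : is_derive t 1 F v -> {for t, continuous F}.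
Proof.
by case=> /derivable1_diffP dF _; exact: differentiable_continuous.
Qed.

(** The norm is the maximum of the coordinates, so the scalar mean value theorem can be applied to
    each coordinate, with its own intermediate point. *)
Lemma mean_value_ineq (R : realType) (n : nat) (F dF : R -> 'rV[R]_n)
    (a b M : R) : a <= b ->
  (forall x, x \in `]a, b[ -> is_derive x 1 F (dF x)) ->
  (forall x, x \in `]a, b[ -> `|dF x| <= M) ->
  {within `[a, b], continuous F} -> `|F b - F a| <= M * (b - a).
Proof.
(* The case [a = b] is split off because [0 <= M] is read off at the midpoint of the open
   interval. *)
move=> ab dFP dFM cF; have [<-|nab] := eqVneq a b.
  by rewrite !subrr normr0 mulr0.
have {}ab : a < b by rewrite lt_neqAle nab.
have M0 : 0 <= M.
  by apply: (le_trans _ (dFM ((a + b) / 2) _)); rewrite // in_itv/= !midf_lt.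
apply: mx_norm_le; first by rewrite mulr_ge0// subr_ge0 ltW.
move=> j; rewrite !mxE.
have cFj : {within `[a, b], continuous (fun s => F s 0 j)}.
  move=> s.
  have := @continuous_cvg _ _ _ _ _ _ (fun u : 'rV[R]_n => u 0 j) _ _ (cF s).
  by apply; exact: coord_continuous.
have [c cab ->] := @MVT R _ (fun x => dF x 0 j) a b ab
  (fun x xab => is_derive_coord j (dFP x xab)) cFj.
rewrite normrM (gtr0_norm (_ : 0 < b - a)) ?subr_gt0// ler_pM2r ?subr_gt0//.
exact: le_trans (mx_norm_coord _ _) (dFM _ cab).
Qed.

Lemma antiderivative (R : realType) (f : R -> R) (a b : R) : continuous f ->
  exists F : R -> R, forall t, t \in `]a, b[ -> is_derive t 1 F (f t).
Proof.
move=> cf; exists (fun x => (\int[lebesgue_measure]_(t in `[a, x]) f t)%R).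
move=> t; rewrite in_itv/= => /andP[aT tb].
have cfab : {within `[a, b], continuous f} by exact: continuous_subspaceT.
have fi := continuous_compact_integrable (@segment_compact R a b) cfab.
have [dF FE] := continuous_FTC1_closed tb fi aT (cf t).
by rewrite derive1E in FE; exact: DeriveDef dF FE.
Qed.

Lemma antiderivative_rV (R : realType) (n : nat) (f : R -> 'rV[R]_n) (a b : R) :
  continuous f ->
  exists F : R -> 'rV[R]_n, forall t, t \in `]a, b[ -> is_derive t 1 F (f t).
Proof.
move=> cf.
have /choice[F FP] j : exists F : R -> R, forall t, t \in `]a, b[ ->
    is_derive t 1 F (f t 0 j).
  apply: antiderivative => s.
  have := @continuous_cvg _ _ _ _ _ _ (fun u : 'rV[R]_n => u 0 j) _ _ (cf s).
  by apply; exact: coord_continuous.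
exists (fun s => \row_j F j s) => t tab; apply: is_derive_rV => j.
have -> : (fun s => (\row_j F j s) 0 j) = F j by apply/funext => s; rewrite mxE.
exact: FP.
Qed.

Lemma is_derive_line (R : realType) (V : normedModType R) (u w : V) (s : R) :
  is_derive s 1 (fun t => u + t *: w) w.
Proof.
have dw : is_diff s (fun t : R => t *: w) (fun t : R => t *: w).
  exact: is_diff_scalel.
have dcw : is_diff s (fun t => u + t *: w) (0 + (fun t : R => t *: w)).
  exact: is_diffD.
have dc : differentiable (fun t : R => u + t *: w) s by case: dcw.
apply: DeriveDef; first exact/derivable1_diffP.
by rewrite deriveE// diff_val /= add0r scale1r.
Qed.

(** The finitely many partial derivatives are continuous at [e], hence bounded on a common closed
    ball; the ball is convex, so the mean value inequality applies along segments. *)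
Lemma Ck1_locally_lipschitz (R : realType) (n m : nat) (U : set 'rV[R]_n)
    (X : 'rV[R]_n -> 'rV[R]_m) (e : 'rV[R]_n) :
  nbhs e U -> Ck 1 U X ->
  exists r K : R, [/\ 0 < r, 0 < K,
    forall u, `|u - e| <= r -> U u &
    forall u v, `|u - e| <= r -> `|v - e| <= r ->
      `|X v - X u| <= K * `|v - u|].
Proof.
move=> Ue [dX cX].
pose B (j : 'I_n) : R := `|'D_(delta_mx 0 j) X e| + 1.
have nearB : \forall u \near e, forall j, `|'D_(delta_mx 0 j) X u| <= B j.
  have nearBj j : \forall u \near e, `|'D_(delta_mx 0 j) X u| <= B j.
    have := cX (delta_mx 0 j) e (mem_set (nbhs_singleton Ue)).
    by move/cvgr_norm_le; apply; rewrite ltrDl.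
  exact: filter_forall nearBj.
pose V := U `&` [set u | forall j, `|'D_(delta_mx 0 j) X u| <= B j].
have /nbhs_closedballP[r rU] : nbhs e V.
  exact: filterI.
have r0 : 0 < r%:num by [].
have ballr u : `|u - e| <= r%:num -> V u.
  by move=> ur; apply: rU; rewrite closed_ballE// /closed_ball_/= distrC.
have B0 : 0 <= \sum_j B j by apply: sumr_ge0 => j _; rewrite addr_ge0.
exists r%:num, (\sum_j B j + 1); split => //.
- by rewrite ltr_wpDl.
- by move=> u /ballr[].
move=> u v ur vr.
pose c (s : R) : 'rV[R]_n := u + s *: (v - u).
have cball (s : R) : s \in `[0, 1] -> `|c s - e| <= r%:num.
  rewrite in_itv/= => /andP[s0 s1].
  have -> : c s - e = (1 - s) *: (u - e) + s *: (v - e).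
    by apply/rowP => j; rewrite !mxE; ring.
  rewrite (le_trans (ler_normD _ _))// !normrZ (ger0_norm s0).
  rewrite ger0_norm ?subr_ge0//.
  have -> : r%:num = (1 - s) * r%:num + s * r%:num by ring.
  by rewrite lerD// ler_wpM2l// subr_ge0.
have dc (s : R) : is_derive s 1 c (v - u).
  exact: is_derive_line.
have dXc (s : R) : s \in `[0, 1] -> is_derive s 1 (X \o c) ('d X (c s) (v - u)).
  move=> s01; have [Uc _] := ballr _ (cball _ s01).
  have dXcs : differentiable X (c s) by apply: dX; rewrite inE.
  have dcs : differentiable c s by apply/derivable1_diffP; case: (dc s).
  apply: DeriveDef; first by apply/derivable1_diffP; exact: differentiable_comp.
  rewrite deriveE; last exact: differentiable_comp.
  have dcE : 'd c s 1 = v - u by rewrite -deriveE//; case: (dc s).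
  by rewrite diff_comp//= dcE.
pose dXcs (s : R) : 'rV[R]_m := 'd X (c s) (v - u).
pose M := (\sum_j B j + 1) * `|v - u|.
have H1 (s : R) : s \in `]0, 1[ -> is_derive s 1 (X \o c) (dXcs s).
  by move=> s01; apply: dXc; exact: subset_itv_oo_cc s01.
have H2 (s : R) : s \in `]0, 1[ -> `|dXcs s| <= M.
  move=> /subset_itv_oo_cc s01; have [Uc /= DB] := ballr _ (cball _ s01).
  have dX' : differentiable X (c s) by apply: dX; rewrite inE.
  (* Expanding [v - u] in the standard basis reduces the bound to the partial derivatives. *)
  rewrite /dXcs [X in 'd _ _ X]row_sum_delta linear_sum/=.
  rewrite (le_trans (ler_norm_sum _ _ _))//.
  rewrite /M mulrDl mul1r mulr_suml ler_wpDr// ler_sum// => j _.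
  rewrite linearZ/= normrZ mulrC ler_pM//; last exact: mx_norm_coord.
  by rewrite -deriveE.
have H3 : {within `[0, 1], continuous (X \o c)}.
  by apply: derivable_within_continuous => s s01; case: (dXc s s01).
have := mean_value_ineq ler01 H1 H2 H3.
by rewrite subr0 mulr1 /c/= scale1r scale0r addr0 addrCA subrr addr0.
Qed.

Lemma exists_geometric_lt (R : realType) (C eps : R) : 0 < eps ->
  exists k, C * 2^-1 ^+ k < eps.
Proof.
move=> e0; have /(cvg_geometric C) : `|2^-1 : R| < 1.
  by rewrite gtr0_norm ?invr_gt0// invf_lt1// ltr1n.
by move=> /cvgr_lt/(_ _ e0)[N _ /(_ N (leqnn N)) H]; exists N.
Qed.

(** Derivatives exist on an open interval around both [0] and [s], so continuity on the closed
    segment between them is automatic, whatever the sign of [s]. *)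
Lemma mean_value_ineq0 (R : realType) (n : nat) (F dF : R -> 'rV[R]_n)
    (a b M s : R) : a < 0 -> 0 < b -> s \in `]a, b[ -> F 0 = 0 ->
  (forall x, x \in `]a, b[ -> is_derive x 1 F (dF x)) ->
  (forall x, x \in `]a, b[ -> `|dF x| <= M) -> `|F s| <= M * `|s|.
Proof.
move=> a0 b0; rewrite in_itv/= => /andP[sa sb] F0 dFP dFM.
have mvi (c d : R) : a < c -> d < b -> c <= d -> `|F d - F c| <= M * (d - c).
  move=> ac db cd.
  have sub (x : R) : x \in `[c, d] -> x \in `]a, b[.
    rewrite !in_itv/= => /andP[cx xd].
    by rewrite (lt_le_trans ac cx) (le_lt_trans xd db).
  have H1 (x : R) : x \in `]c, d[ -> is_derive x 1 F (dF x).
    by move=> /subset_itv_oo_cc /sub; exact: dFP.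
  have H2 (x : R) : x \in `]c, d[ -> `|dF x| <= M.
    by move=> /subset_itv_oo_cc /sub; exact: dFM.
  apply: (mean_value_ineq cd H1 H2).
  by apply: derivable_within_continuous => x /sub /dFP[].
have [s0|s0] := leP 0 s.
  by have := mvi 0 s a0 sb s0; rewrite F0 !subr0 ger0_norm.
by have := mvi s 0 sa b0 (ltW s0); rewrite F0 !sub0r normrN ltr0_norm.
Qed.

Section picard.
Context {R : realType} {n : nat} (X : 'rV[R]_n -> 'rV[R]_n) (e : 'rV[R]_n).
Variables (r K : R).
Hypotheses (r0 : 0 < r) (K0 : 0 < K).
Hypothesis XK : forall u v, `|u - e| <= r -> `|v - e| <= r ->
  `|X v - X u| <= K * `|v - u|.

Let M := `|X e| + K * r.
(** One formula in place of a minimum: its inverse [d] satisfies [d <= 1], [K * d <= 2^-1] and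
    [M * d <= r] at once. These keep times inside []-2, 2[], make the Picard operator halve
    distances, and keep curves in the ball. *)
Let D := 1 + 2 * K + M / r.
Let d := D^-1.

Let M0 : 0 <= M. Proof. by rewrite addr_ge0// mulr_ge0// ltW. Qed.
Let D0 : 0 < D.
Proof. by rewrite ltr_wpDr ?divr_ge0 ?(ltW r0)// addr_gt0// mulr_gt0. Qed.
Let d0 : 0 < d. Proof. by rewrite invr_gt0. Qed.
Let d1 : d <= 1.
Proof.
rewrite invf_le1// /D -addrA lerDl addr_ge0 ?divr_ge0 ?(ltW r0)//.
by rewrite mulr_ge0// ltW.
Qed.
Let dK : K * d <= 2^-1.
Proof.
rewrite /d ler_pdivrMr// mulrC -ler_pdivrMr ?invr_gt0// invrK mulrC /D.
by rewrite addrAC lerDr addr_ge0// divr_ge0// ltW.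
Qed.
Let dM : M * d <= r.
Proof.
rewrite /d ler_pdivrMr// mulrC -ler_pdivrMr// /D.
by rewrite lerDr addr_ge0// mulr_ge0// ltW.
Qed.

(** Freezing time outside [[-d, d]] lets the iterates be continuous functions on all of [R], so no
    function space over an interval is needed. *)
Let clip (t : R) : R := Num.max (- d) (Num.min d t).

Let clip_le t : `|clip t| <= d.
Proof.
rewrite ler_norml /clip le_max lexx/= ge_max ge_min lexx andbT.
by rewrite (@le_trans _ _ 0)// ?oppr_le0 ltW.
Qed.

Let clip2 t : clip t \in `](-2 : R), 2[.
Proof.
have d2 : d < 2 by rewrite (le_lt_trans d1)// ltr1n.
by rewrite in_itv/= -ltr_norml (le_lt_trans (clip_le t)).
Qed.

Let clip_id t : `|t| <= d -> clip t = t.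
Proof. by rewrite ler_norml => /andP[td1 td2]; rewrite /clip min_r// max_r. Qed.

Let clip_continuous : continuous clip.
Proof.
move=> t; apply: (@continuous_max R R (cst (- d)) (cst d \min id) t).
  exact: cvg_cst.
by apply: (@continuous_min R R (cst d) id t); [exact: cvg_cst|exact: cvg_id].
Qed.

Let S (u : R -> 'rV[R]_n) := continuous u /\ forall t, `|u t - e| <= r.

Let XM v : `|v - e| <= r -> `|X v| <= M.
Proof.
move=> vr; rewrite -(subrK (X e) (X v)) addrC.
rewrite (le_trans (ler_normD _ _))// lerD2l (le_trans (XK _ vr))//.
  by rewrite subrr normr0 ltW.
by rewrite ler_pM2l.
Qed.

Let S_continuous u : S u -> continuous (X \o u).
Proof.
move=> [cu ur] t; apply/cvgrPdist_lt => eps e0.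
have e1 : 0 < eps / K by rewrite divr_gt0.
have /cvgrPdist_lt/(_ _ e1) := cu t; apply: filterS => s /= us.
by rewrite (le_lt_trans (XK _ _))// -ltr_pdivlMl// mulrC.
Qed.

(** Continuity is assumed under the existential, so that a single choice defines the operator [A] on
    all functions. *)
Let antiderivative0 (f : R -> 'rV[R]_n) : exists F : R -> 'rV[R]_n,
  continuous f -> F 0 = 0 /\
  forall t, t \in `](-2 : R), 2[ -> is_derive t 1 F (f t).
Proof.
have [cf|ncf] := pselect (continuous f); last by exists 0.
have [F FP] := antiderivative_rV (-2) 2 cf.
exists (fun t => F t - F 0) => _; split; first by rewrite subrr.
move=> t /FP dF; rewrite -[X in is_derive _ _ _ X]subr0.
exact: is_deriveB.
Qed.

Let A f := sval (cid (antiderivative0 f)).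
Let A0 f : continuous f -> A f 0 = 0.
Proof. by rewrite /A; case: cid => F /= H /H[]. Qed.
Let dA f t : continuous f -> t \in `](-2 : R), 2[ -> is_derive t 1 (A f) (f t).
Proof. by rewrite /A; case: cid => F /= H /H[_]; exact. Qed.

(** The Picard operator: [e] plus the integral of [X \o u] from 0 to the clipped time. *)
Let T u t := e + A (X \o u) (clip t).

Let ST u : S u -> S (T u).
Proof.
move=> Su; have [cu ur] := Su; have cX := S_continuous Su; split.
  move=> t; apply: cvgD; first exact: cvg_cst.
  have cA := is_derive_continuous (dA cX (clip2 t)).
  exact: (@continuous_comp _ _ _ clip (A (X \o u)) t (@clip_continuous t) cA).
move=> t; rewrite /T addrC addKr.
have H2 x : x \in `](-2 : R), 2[ -> `|(X \o u) x| <= M by move=> _; exact: XM.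
have := mean_value_ineq0 _ _ (clip2 t) (A0 cX) (fun x => dA cX) H2.
rewrite oppr_lt0 !ltr0n => /(_ isT isT)/le_trans; apply.
by rewrite (le_trans _ dM)// ler_wpM2l.
Qed.

Let T_contraction u v C : S u -> S v -> (forall t, `|u t - v t| <= C) ->
  forall t, `|T u t - T v t| <= C / 2.
Proof.
move=> Su Sv uvC t; have [[cu ur] [cv vr]] := (Su, Sv).
have cXu := S_continuous Su; have cXv := S_continuous Sv.
have C0 : 0 <= C by exact: le_trans (uvC 0).
rewrite /T opprD addrACA subrr add0r.
have H0 : (A (X \o u) - A (X \o v)) 0 = 0.
  by rewrite -[LHS]/(A (X \o u) 0 - A (X \o v) 0) (A0 cXu) (A0 cXv) subrr.
have H1 (x : R) : x \in `](-2 : R), 2[ ->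
    is_derive x 1 (A (X \o u) - A (X \o v)) (X (u x) - X (v x)).
  by move=> x2; apply: is_deriveB; exact: dA.
have H2 (x : R) : x \in `](-2 : R), 2[ -> `|X (u x) - X (v x)| <= K * C.
  by move=> _; rewrite (le_trans (XK _ _))// ler_pM2l.
have := mean_value_ineq0 _ _ (clip2 t) H0 H1 H2.
rewrite oppr_lt0 !ltr0n => /(_ isT isT)/le_trans; apply.
rewrite mulrAC mulrC ler_wpM2l// (le_trans _ dK)//.
by rewrite ler_pM2l.
Qed.

Let u_ k := iter k T (cst e).

Let Su_ k : S (u_ k).
Proof.
elim: k => [|k IH]; last exact: ST.
split=> t; first exact: cvg_cst.
by rewrite /u_/= subrr normr0 ltW.
Qed.

(** Both curves are [k]-fold images under [T], of [u_ m] and of the constant [e], which are at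
    distance at most [r]; each application of [T] halves the bound. *)
Let u_dist k m t : `|u_ (k + m) t - u_ k t| <= r * 2^-1 ^+ k.
Proof.
elim: k t => [|k IH] t; first by rewrite expr0 mulr1; case: (Su_ m) => _; apply.
by rewrite addSn exprSr mulrA; apply: T_contraction IH t; exact: Su_.
Qed.

Let u_cvg t : cvgn (fun k => u_ k t).
Proof.
apply/cauchy_cvgP/cauchy_exP => eps e0.
have [k kr] := exists_geometric_lt r e0.
exists (u_ k t); exists k => // m /= km.
rewrite -ball_normE/= distrC (le_lt_trans _ kr)//.
by rewrite -(subnKC km) u_dist.
Qed.

Let L t := limn (fun k => u_ k t).

Let L_dist k t : `|L t - u_ k t| <= r * 2^-1 ^+ k.
Proof.
apply/ler_addgt0Pr => eps e0.
have uL : u_ k t @[k --> \oo] --> L t := @u_cvg t.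
have /cvgrPdist_lt/(_ _ e0)[N _ /(_ (k + N)%N (leq_addl _ _)) /= H] := uL.
rewrite (le_trans (ler_distD (u_ (k + N) t) _ _))// addrC lerD ?u_dist//.
exact: ltW.
Qed.

(** By [L_dist] the convergence is uniform in [t], so continuity passes to the limit by the usual
    three-term estimate. *)
Let SL : S L.
Proof.
split; last by move=> t; have := L_dist 0 t; rewrite expr0 mulr1.
move=> t; apply/cvgrPdist_lt => eps e0.
have e3 : 0 < eps / 3 by rewrite divr_gt0.
have [k kr] := exists_geometric_lt r e3.
have [+ _] := Su_ k; move=> /(_ t)/cvgrPdist_lt/(_ _ e3).
apply: filterS => s us.
rewrite (le_lt_trans (ler_distD (u_ k t) _ _))//.
have -> : eps = eps / 3 + (eps / 3 + eps / 3) by field.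
rewrite ltrD//; first exact: le_lt_trans (L_dist k t) kr.
rewrite (le_lt_trans (ler_distD (u_ k s) _ _))// ltrD//.
by rewrite distrC; exact: le_lt_trans (L_dist k s) kr.
Qed.

(** [T L] and [L] are both close to [u_ k.+1]: the first by contraction, the second by the rate of
    convergence. The two errors add up to [r * 2^-1 ^+ k]. *)
Let TL t : T L t = L t.
Proof.
apply/eqP; rewrite -subr_eq0 -normr_le0; apply/ler_addgt0Pr => eps e0.
have [k kr] := exists_geometric_lt r e0; rewrite add0r.
rewrite (le_trans _ (ltW kr))// (le_trans (ler_distD (u_ k.+1 t) _ _))//.
have -> : r * 2^-1 ^+ k = r * 2^-1 ^+ k / 2 + r * 2^-1 ^+ k.+1.
  by rewrite exprSr; field.
rewrite lerD//; last by rewrite distrC.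
by apply: T_contraction (L_dist k) t => //; exact: Su_.
Qed.

Lemma picard_lipschitz : exists (del : R) (c : R -> 'rV[R]_n),
  [/\ 0 < del, c 0 = e & forall t, t \in `](- del), del[ ->
      `|c t - e| <= r /\ is_derive t 1 c (X (c t))].
Proof.
have cXL := S_continuous SL; exists d, L; split => //.
  by rewrite -TL /T clip_id ?normr0 ?(ltW d0)// A0// addr0.
move=> t td; split; first by case: SL.
have t2 : t \in `](-2 : R), 2[.
  rewrite -(@clip_id t) ?clip2// ltW//.
  by rewrite ltr_norml; move: td; rewrite in_itv.
have dt : is_derive t 1 (cst e + A (X \o L)) (X (L t)).
  by rewrite -[X (L t)]add0r; apply: is_deriveD; exact: dA.
(* Near a time inside []-d, d[] clipping is the identity, so the fixed-point equation shows that [L]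
   agrees there with [e + A (X \o L)]. *)
apply: near_eq_is_derive dt.
have := near_in_itvoo td; apply: filterS => s sd.
rewrite -TL /T clip_id// ltW//.
by rewrite ltr_norml; move: sd; rewrite in_itv.
Qed.

End picard.

(** * Calculus along curves and slices *)

Lemma is_derive_quotient (R : realType) (V : normedModType R) (F : R -> V)
    (t : R) (w : V) :
  is_derive t 1 F w <-> h^-1 *: (F (t + h) - F t) @[h --> 0^'] --> w.
Proof.
have E : (fun h => h^-1 *: (F (t + h) - F t)) =
    (fun h => h^-1 *: ((F \o shift t) (h *: 1) - F t)).
  by apply/funext => h /=; rewrite [h *: 1]mulr1 [t + h]addrC.
rewrite E; split=> [[dF <-]|Fw]; first exact: dF.
by apply: DeriveDef; [exact: cvgP Fw|exact: cvg_lim Fw].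
Qed.

Lemma is_derive_comp_diff (R : realType) (V W : normedModType R)
    (c : R -> V) (f : V -> W) (t : R) (w : V) :
  is_derive t 1 c w -> differentiable f (c t) ->
  is_derive t 1 (f \o c) ('d f (c t) w).
Proof.
move=> dc df; have dct : differentiable c t.
  by apply/derivable1_diffP; case: dc.
apply: DeriveDef; first exact/derivable1_diffP/differentiable_comp.
rewrite deriveE; last exact: differentiable_comp.
have <- : 'd c t 1 = w by rewrite -deriveE//; case: dc.
by rewrite diff_comp.
Qed.

Lemma is_derive_affine (R : realType) (V : normedModType R) (F : R -> V)
    (a b t : R) (w : V) :
  is_derive (a * t + b) 1 F w ->
  is_derive t 1 (fun s => F (a * s + b)) (a *: w).
Proof.
move=> dF.
have dl : is_derive t 1 (fun s : R => b + s *: a) a by exact: is_derive_line.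
have -> : (fun s => F (a * s + b)) = F \o (fun s : R => b + s *: a).
  by apply/funext => s /=; rewrite addrC [a * s]mulrC.
have lt : b + t *: a = a * t + b by rewrite addrC [a * t]mulrC.
have df : differentiable F (b + t *: a).
  by rewrite lt; apply/derivable1_diffP; case: dF.
have dlt : differentiable (fun s : R => b + s *: a) t.
  by apply/derivable1_diffP; case: dl.
have := is_derive_comp_diff dl df.
have E : 'd F (b + t *: a) 1 = w.
  by rewrite -deriveE// lt; case: dF.
have linE (l : {linear R -> V}) : l a = a *: l 1.
  by rewrite -linearZ; congr (l _); rewrite /= [_ *: 1]mulr1.
by rewrite linE E.
Qed.

Lemma is_derive_pair (R : realType) (V W : normedModType R)
    (a : R -> V) (b : R -> W) (t : R) (v : V) (w : W) :
  is_derive t 1 a v -> is_derive t 1 b w ->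
  is_derive t 1 (fun s => (a s, b s)) (v, w).
Proof.
move=> da db.
have dat : differentiable a t by apply/derivable1_diffP; case: da.
have dbt : differentiable b t by apply/derivable1_diffP; case: db.
have dp := differentiable_pair dat dbt.
apply: DeriveDef; first exact/derivable1_diffP.
rewrite deriveE// diff_pair//=.
by congr pair; rewrite -deriveE//; [case: da|case: db].
Qed.

Section derive_slice.
Context {R : realType} {V W Z : normedModType R}.

(** The difference quotients coincide, so this is an equality of functions without any
    differentiability, and it can be rewritten under [Ck] in the induction of [Ck_slicel]. *)
Lemma derive_slicel (f : V * W -> Z) (b : W) (v : V) :
  'D_v (fun u => f (u, b)) = (fun u => 'D_(v, 0) f (u, b)).
Proof.
apply/funext => u; rewrite /derive.
suff -> : (fun h : R =>
      h^-1 *: (((fun x => f (x, b)) \o shift u) (h *: v) - f (u, b))) =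
    (fun h => h^-1 *: ((f \o shift (u, b)) (h *: ((v, 0) : V * W)) - f (u, b)))
    by [].
apply/funext => h /=; congr (_ *: (f _ - _)).
by congr pair; rewrite /= scaler0 add0r.
Qed.

Lemma derive_slicer (f : V * W -> Z) (a : V) (w : W) :
  'D_w (fun u => f (a, u)) = (fun u => 'D_(0, w) f (a, u)).
Proof.
apply/funext => u; rewrite /derive.
suff -> : (fun h : R =>
      h^-1 *: (((fun x => f (a, x)) \o shift u) (h *: w) - f (a, u))) =
    (fun h => h^-1 *: ((f \o shift (a, u)) (h *: ((0, w) : V * W)) - f (a, u)))
    by [].
apply/funext => h /=; congr (_ *: (f _ - _)).
by congr pair; rewrite /= scaler0 add0r.
Qed.

Lemma differentiable_slicel (f : V * W -> Z) (u : V) (b : W) :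
  differentiable f (u, b) -> differentiable (fun x => f (x, b)) u.
Proof.
by move=> df; apply: (@differentiable_comp _ _ _ _ (fun x => (x, b)) f).
Qed.

Lemma differentiable_slicer (f : V * W -> Z) (a : V) (u : W) :
  differentiable f (a, u) -> differentiable (fun x => f (a, x)) u.
Proof.
by move=> df; apply: (@differentiable_comp _ _ _ _ (fun x => (a, x)) f).
Qed.

Lemma diff_slicel (f : V * W -> Z) (a : V) (b : W) (v : V) :
  differentiable f (a, b) ->
  'd (fun u => f (u, b)) a v = 'd f (a, b) (v, 0).
Proof.
move=> df; have dl := differentiable_slicel df.
have E := congr1 (@^~ a) (derive_slicel f b v).
exact: etrans (esym (deriveE v dl)) (etrans E (deriveE (v, 0) df)).
Qed.

Lemma diff_slicer (f : V * W -> Z) (a : V) (b : W) (w : W) :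
  differentiable f (a, b) ->
  'd (fun u => f (a, u)) b w = 'd f (a, b) (0, w).
Proof.
move=> df; have dr := differentiable_slicer df.
have E := congr1 (@^~ b) (derive_slicer f a w).
exact: etrans (esym (deriveE w dr)) (etrans E (deriveE (0, w) df)).
Qed.

Lemma Ck_slicel k (U : set (V * W)) (f : V * W -> Z) (b : W) :
  Ck k U f -> Ck k [set u | U (u, b)] (fun u => f (u, b)).
Proof.
elim: k f => [|k IH] f /=.
  move=> cf u /set_mem Uu.
  apply: (@continuous_comp _ _ _ (fun x => (x, b)) f).
    by apply: differentiable_continuous; exact: differentiable_pair.
  by apply: cf; rewrite inE.
move=> [df cf]; split=> [u /set_mem Uu|v].
  by apply: differentiable_slicel; apply: df; rewrite inE.
by rewrite derive_slicel; exact: IH (cf _).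
Qed.

Lemma Ck_slicer k (U : set (V * W)) (f : V * W -> Z) (a : V) :
  Ck k U f -> Ck k [set u | U (a, u)] (fun u => f (a, u)).
Proof.
elim: k f => [|k IH] f /=.
  move=> cf u /set_mem Uu.
  apply: (@continuous_comp _ _ _ (fun x => (a, x)) f).
    by apply: differentiable_continuous; exact: differentiable_pair.
  by apply: cf; rewrite inE.
move=> [df cf]; split=> [u /set_mem Uu|v].
  by apply: differentiable_slicer; apply: df; rewrite inE.
by rewrite derive_slicer; exact: IH (cf _).
Qed.

End derive_slice.

(** * Curves in manifolds *)

Section manifold.
Context {R : realType} {n : nat} {M : manifoldType R n}.
Implicit Types (x : M) (phi psi : chart R n M).

Lemma exists_chart_at x : exists phi, chart_at x phi.
Proof. by have [phi aphi xphi] := atlas_cover x; exists phi. Qed.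

Lemma chart_at_cod x phi : chart_at x phi -> chart_cod phi (phi x).
Proof. by move=> [_]; exact: chart_funS. Qed.

Lemma chart_at_inv x phi : chart_at x phi -> chart_inv phi (phi x) = x.
Proof. by move=> [_ xphi]; rewrite chart_funK ?inE. Qed.

Lemma nbhs_chart_dom x phi : chart_at x phi -> nbhs x (chart_dom phi).
Proof.
by move=> [_ xphi]; apply: open_nbhs_nbhs; split => //; exact: chart_dom_open.
Qed.

Lemma nbhs_chart_cod x phi : chart_at x phi -> nbhs (phi x) (chart_cod phi).
Proof.
move=> xphi; apply: open_nbhs_nbhs; split; first exact: chart_cod_open.
exact: chart_at_cod.
Qed.

Lemma near_chart_inv x phi (A : set M) : chart_at x phi -> nbhs x A ->
  \forall u \near phi x, A (chart_inv phi u).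
Proof.
move=> xphi xA; have codx : phi x \in chart_cod phi.
  by rewrite inE; exact: chart_at_cod.
have := chart_inv_continuous codx.
by rewrite /continuous_at chart_at_inv//; apply.
Qed.

(** Compatibility of the atlas in another guise; it makes a change of charts a special case of
    [is_derive_smooth]. *)
Lemma smooth_map_id : smooth_map (@id M).
Proof.
by split=> [x|phi psi aphi apsi]; [exact: cvg_id|exact: atlas_compatible].
Qed.

(** The coordinates in one chart at [x] determine those in the others through the differentials of
    the chart changes, and those in charts away from [x] are zero by convention. *)
Lemma tangentP x (v w : tangent x) phi : chart_at x phi ->
  v phi = w phi -> v = w.
Proof.
case: v w => [v vt] [w wt] xphi /= vw.
have := vt; have := wt; move=> /asboolP[w0 wP] /asboolP[v0 vP].
suff E : v = w.
  by move: vt wt; rewrite E => vt wt; congr Tangent; exact: bool_irrelevance.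
apply/funext => psi; have [xpsi|nxpsi] := pselect (chart_at x psi).
  by rewrite (vP phi)// (wP phi)// vw.
by rewrite v0// w0.
Qed.

Lemma tangent_change x (v : tangent x) phi psi : chart_at x phi ->
  chart_at x psi -> v psi = 'd (psi \o chart_inv phi) (phi x) (v phi).
Proof. by case: v => v /= /asboolP[_]; apply. Qed.

Lemma tcoordZ x (a : R) (v : tangent x) phi : (a *: v) phi = a *: v phi.
Proof. by []. Qed.

(** Two-sided counterpart of [velocity_within], phrased with [is_derive] so that the rules of
    calculus apply; [has_velocity_within] and [velocity_within_interior] compare the two. *)
Definition has_velocity (gamma : R -> M) (t : R) (v : tangent (gamma t)) :=
  {for t, continuous gamma} /\
  forall phi, chart_at (gamma t) phi -> is_derive t 1 (phi \o gamma) (v phi).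

End manifold.

Lemma smooth_map_differentiable (R : realType) (m n : nat)
    (M : manifoldType R m) (N : manifoldType R n) (f : M -> N) x
    (phi : chart R m M) (psi : chart R n N) :
  smooth_map f -> chart_at x phi -> chart_at (f x) psi ->
  differentiable (psi \o f \o chart_inv phi) (phi x).
Proof.
move=> [_ fs] xphi fpsi; have [+ _] := fs _ _ xphi.1 fpsi.1 1%N.
apply; rewrite inE/= chart_at_inv//; split; first exact: chart_at_cod.
by case: fpsi.
Qed.

(** Functoriality of the tangent map in coordinates. The composite of the chart expressions equals
    the chart expression of the composite only near [phi x], where [f] stays in the domain of
    [psi]. *)
Lemma diff_smooth_comp (R : realType) (m n p : nat) (M : manifoldType R m)
    (N : manifoldType R n) (P : manifoldType R p) (f : M -> N) (g : N -> P) x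
    (phi : chart R m M) (psi : chart R n N) (rho : chart R p P) v :
  smooth_map f -> smooth_map g ->
  chart_at x phi -> chart_at (f x) psi -> chart_at (g (f x)) rho ->
  'd (rho \o (g \o f) \o chart_inv phi) (phi x) v =
  'd (rho \o g \o chart_inv psi) (psi (f x))
    ('d (psi \o f \o chart_inv phi) (phi x) v).
Proof.
move=> sf sg xphi fpsi grho.
pose a := psi \o f \o chart_inv phi; pose b := rho \o g \o chart_inv psi.
have ax : a (phi x) = psi (f x) by rewrite /a/= chart_at_inv.
have da : differentiable a (phi x) by exact: smooth_map_differentiable.
have db : differentiable b (a (phi x)).
  by rewrite ax; exact: smooth_map_differentiable.
have ba : {near phi x, b \o a =1 rho \o (g \o f) \o chart_inv phi}.
  have fN : nbhs x (f @^-1` chart_dom psi).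
    by apply: sf.1; exact: nbhs_chart_dom.
  have := near_chart_inv xphi fN; apply: filterS => u /= fu.
  by rewrite /b /a/= (chart_funK (c := psi)) ?inE.
have [_ dE] := near_eq_diff ba (differentiable_comp da db).
have E := congr1 (@^~ v) (diff_comp da db).
have : 'd (rho \o (g \o f) \o chart_inv phi) (phi x) v =
    ('d b (a (phi x)) \o 'd a (phi x)) v.
  exact: etrans (congr1 (@^~ v) dE) E.
by rewrite ax.
Qed.

Lemma is_derive_smooth (R : realType) (m n : nat) (M : manifoldType R m)
    (N : manifoldType R n) (f : M -> N) (gamma : R -> M) (t : R)
    (phi : chart R m M) (psi : chart R n N) w :
  smooth_map f -> {for t, continuous gamma} ->
  chart_at (gamma t) phi -> chart_at (f (gamma t)) psi ->
  is_derive t 1 (phi \o gamma) w ->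
  is_derive t 1 (psi \o (f \o gamma))
    ('d (psi \o f \o chart_inv phi) (phi (gamma t)) w).
Proof.
move=> sf cg gphi fpsi dg.
have df := smooth_map_differentiable sf gphi fpsi.
have := is_derive_comp_diff dg df; apply: near_eq_is_derive.
have gN : \forall s \near t, chart_dom phi (gamma s).
  exact: cg _ (nbhs_chart_dom gphi).
by move: gN; apply: filterS => s /= gs; rewrite (chart_funK (c := phi)) ?inE.
Qed.

Lemma has_velocity_chart (R : realType) (n : nat) (M : manifoldType R n)
    (gamma : R -> M) (t : R) (v : tangent (gamma t)) (phi : chart R n M) :
  {for t, continuous gamma} -> chart_at (gamma t) phi ->
  is_derive t 1 (phi \o gamma) (v phi) -> has_velocity v.
Proof.
move=> cg gphi dg; split=> // psi gpsi; rewrite (tangent_change v gphi gpsi).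
exact: (is_derive_smooth smooth_map_id cg gphi gpsi dg).
Qed.

(** Used with [a = -1] to reverse time, with [a = 1] to shift it, and with [a = s] to pass from [xi]
    to [s *: xi]. *)
Lemma has_velocity_affine (R : realType) (n : nat) (M : manifoldType R n)
    (gamma : R -> M) (a b t : R) (v : tangent (gamma (a * t + b))) :
  has_velocity v ->
  @has_velocity _ _ _ (fun s => gamma (a * s + b)) t (a *: v).
Proof.
move=> [cg dg]; split.
  apply: (@continuous_comp _ _ _ (fun s : R => a * s + b) gamma) => //.
  by apply: cvgD; [apply: cvgMr; exact: cvg_id|exact: cvg_cst].
move=> phi gphi; rewrite tcoordZ.
exact: (@is_derive_affine _ _ (phi \o gamma)) (dg phi gphi).
Qed.

Lemma within_cvg_subset (T : Type) (U : topologicalType) (F : set_system T)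
    (A B : set T) (f : T -> U) (y : U) : Filter F -> A `<=` B ->
  f s @[s --> within B F] --> y -> f s @[s --> within A F] --> y.
Proof.
move=> FF AB Bf C Cy; apply: (@filterS _ F FF) (Bf C Cy) => s /= BC As.
exact/BC/AB.
Qed.

(** In a chart the mean value inequality with bound 0 gives local constancy, up to the endpoints by
    continuity; connectedness of [[a, b]] makes it global. *)
Lemma eq_of_velocity0 (R : realType) (n : nat) (M : manifoldType R n)
    (f : R -> M) (a b : R) : a <= b ->
  (forall t, t \in `[a, b] ->
    f s @[s --> within `[a, b]%classic (nbhs t)] --> f t) ->
  (forall t, t \in `]a, b[ -> has_velocity (0 : tangent (f t))) ->
  f a = f b.
Proof.
move=> ab cf df.
have loc (t : R) : t \in `[a, b] ->
    \forall s \near within `[a, b]%classic (nbhs t), f s = f t.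
  move=> tab; have [phi ftphi] := exists_chart_at (f t).
  have /nbhs_ballP[eps /= e0 eP] := cf t tab _ (nbhs_chart_dom ftphi).
  (* The segment from [c] to [d] stays in the ball, so [f] maps it into one chart domain, where
     equal coordinates mean equal points. *)
  have inj (c d : R) : c <= d -> c \in `[a, b] -> d \in `[a, b] ->
      ball t eps c -> ball t eps d -> f c = f d.
    rewrite !in_itv/= => cd /andP[ac cb] /andP[ad db].
    rewrite -!ball_normE /= !ltr_distlC => /andP[tc ct] /andP[td dt].
    have sub (x : R) : x \in `[c, d] -> x \in `[a, b].
      rewrite !in_itv/= => /andP[cx xd].
      by rewrite (le_trans ac cx) (le_trans xd db).
    have subo (x : R) : x \in `]c, d[ -> x \in `]a, b[.
      rewrite !in_itv/= => /andP[cx xd].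
      by rewrite (le_lt_trans ac cx) (lt_le_trans xd db).
    have domP (x : R) : x \in `[c, d] -> chart_at (f x) phi.
      move=> xcd; split; first by case: ftphi.
      apply: (eP x); last exact: sub.
      move: xcd; rewrite -ball_normE/= in_itv/= => /andP[cx xd].
      by rewrite ltr_distlC (lt_le_trans tc cx) (le_lt_trans xd dt).
    have H1 (x : R) : x \in `]c, d[ -> is_derive x 1 (phi \o f) (cst 0 x).
      move=> xcd; have [_ /(_ phi)] := df x (subo x xcd).
      by apply; apply: domP; exact: subset_itv_oo_cc xcd.
    have H2 (x : R) : x \in `]c, d[ -> `|(cst 0 x : 'rV[R]_n)| <= 0.
      by rewrite normr0.
    have H3 : {within `[c, d], continuous (phi \o f)}.
      apply/subspace_continuousP => x xcd.
      have cphi : {for f x, continuous phi}.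
        by apply: chart_fun_continuous; rewrite inE; case: (domP x xcd).
      apply: (continuous_cvg _ cphi).
      apply: (@within_cvg_subset _ _ _ _ `[a, b]%classic).
        by move=> y; exact: sub.
      exact: cf x (sub x xcd).
    have := mean_value_ineq cd H1 H2 H3.
    rewrite mul0r normr_le0 subr_eq0 => /eqP/= E.
    have cc : c \in `[c, d] by rewrite in_itv/= lexx.
    have dd : d \in `[c, d] by rewrite in_itv/= lexx cd.
    by rewrite -(chart_at_inv (domP c cc)) -E (chart_at_inv (domP d dd)).
  apply/nbhs_ballP; exists eps => //= s st sab.
  have tt : ball t eps t by exact: ballxx.
  have [ts|/ltW ts] := leP t s; last exact: inj.
  by apply/esym; exact: inj.
apply: contrapT => fab.
(* Local constancy makes this indicator continuous; if [f b] differed from [f a] it would have to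
   take the value 1/2. *)
pose chi (s : R) : R := if pselect (f s = f a) then 0 else 1.
have cchi : {within `[a, b], continuous chi}.
  apply/subspace_continuousP => t tab.
  have chiE : \forall s \near within `[a, b]%classic (nbhs t), chi t = chi s.
    by apply: filterS (loc t tab) => s; rewrite /chi => ->.
  apply: (cvg_trans (near_eq_cvg chiE)); exact: cvg_cst.
have chia : chi a = 0 by rewrite /chi; case: pselect.
have chib : chi b = 1.
  by rewrite /chi; case: pselect => // E; case: fab; rewrite E.
have [|c _] := @IVT R chi a b 2^-1 ab cchi.
  rewrite chia chib min_l ?ler01// max_r ?ler01// invr_ge0 ler0n/=.
  by rewrite invf_le1 ?ltr0n// ler1n.
rewrite /chi; case: pselect => _ /eqP.
  by rewrite eq_sym invr_eq0 pnatr_eq0.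
by rewrite -[X in X == _]invr1 (inj_eq invr_inj) -[1]/(1%:R) eqr_nat.
Qed.

(** * Translations and integral curves in a Lie group *)

Section lie_group.
Context {R : realType} {n : nat} {G : lieGroupType R n}.
Implicit Types (g h : G) (phi psi : chart R n G) (xi : lie_algebra G).

Lemma translate_left_continuous g : continuous (translate_left g).
Proof.
move=> h; apply: (@continuous_comp _ _ _ (fun h => (g, h))
  (fun p : G * G => (p.1 * p.2)%g)); last exact: mulg_continuous.
by apply: cvg_pair => //=; exact: cvg_cst.
Qed.

Lemma translate_right_continuous g : continuous (translate_right g).
Proof.
move=> h; apply: (@continuous_comp _ _ _ (fun h => (h, g))
  (fun p : G * G => (p.1 * p.2)%g)); last exact: mulg_continuous.
by apply: cvg_pair => //=; exact: cvg_cst.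
Qed.

(** Left translation is the multiplication with its first coordinate frozen at [chi g], so
    [Ck_slicer] applies. *)
Lemma smooth_translate_left g : smooth_map (translate_left g).
Proof.
split=> [|phi psi aphi apsi k]; first exact: translate_left_continuous.
have [chi gchi] := exists_chart_at g.
have := Ck_slicer (chi g) (mulg_smooth _ _ _ gchi.1 aphi apsi k).
rewrite /= chart_at_inv//; congr Ck.
apply/seteqP; split=> u /= [] //.
by move=> phiu psiu; split => //; exact: chart_at_cod.
Qed.

Lemma smooth_translate_right g : smooth_map (translate_right g).
Proof.
split=> [|phi psi aphi apsi k]; first exact: translate_right_continuous.
have [chi gchi] := exists_chart_at g.
have := Ck_slicel (chi g) (mulg_smooth _ _ _ aphi gchi.1 apsi k).
rewrite /= chart_at_inv//; congr Ck.
apply/seteqP; split=> u /= [] //.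
by move=> phiu psiu; split => //; exact: chart_at_cod.
Qed.

(** Changing the base point along an equality leaves coordinates alone, so the casts in [tmap_left]
    and [tmap_right] vanish in charts. *)
Lemma tcoord_cast g h (E : g = h) (v : tangent g) phi :
  ecast z (tangent z) E v phi = v phi.
Proof. by case: _ / E. Qed.

Lemma tmap_leftE g xi phi psi : chart_at 1%g phi -> chart_at g psi ->
  tmap_left g xi psi =
  'd (psi \o translate_left g \o chart_inv phi) (phi 1%g) (xi phi).
Proof.
move=> phi1 gpsi; rewrite tcoord_cast.
rewrite (tmapE xi (smooth_translate_left g) phi1)//.
by rewrite /translate_left mulg1.
Qed.

Lemma tmap_rightE g xi phi psi : chart_at 1%g phi -> chart_at g psi ->
  tmap_right g xi psi =
  'd (psi \o translate_right g \o chart_inv phi) (phi 1%g) (xi phi).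
Proof.
move=> phi1 gpsi; rewrite tcoord_cast.
rewrite (tmapE xi (smooth_translate_right g) phi1)//.
by rewrite /translate_right mul1g.
Qed.

(** Leibniz rule: the differential of the multiplication at a pair is linear, so it splits over
    [(v, 0)] and [(0, w)], and these parts are the differentials of the two translations. *)
Lemma has_velocity_mulg (a b : R -> G) (t : R) (v : tangent (a t))
    (w : tangent (b t)) : has_velocity v -> has_velocity w ->
  @has_velocity _ _ G (fun s => a s * b s)%g t
    (tmap (translate_right (b t)) v + tmap (translate_left (a t)) w).
Proof.
move=> [ca da] [cb db]; split.
  apply: (@continuous_comp _ _ _ (fun s => (a s, b s))
    (fun p : G * G => (p.1 * p.2)%g)); last exact: mulg_continuous.
  exact: cvg_pair.
move=> psi abpsi; have [phi1 aphi1] := exists_chart_at (a t).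
have [phi2 bphi2] := exists_chart_at (b t).
pose F (u : 'rV[R]_n * 'rV[R]_n) : 'rV[R]_n :=
  psi (chart_inv phi1 u.1 * chart_inv phi2 u.2)%g.
have dF : differentiable F (phi1 (a t), phi2 (b t)).
  have [+ _] := mulg_smooth _ _ _ aphi1.1 bphi2.1 abpsi.1 1%N.
  apply; rewrite inE/=; split; [exact: chart_at_cod|exact: chart_at_cod|].
  by rewrite !chart_at_inv//; case: abpsi.
have dab := is_derive_pair (da phi1 aphi1) (db phi2 bphi2).
have := is_derive_comp_diff dab dF.
have El : tmap (translate_right (b t)) v psi =
    'd F (phi1 (a t), phi2 (b t)) (v phi1, 0).
  rewrite -(diff_slicel _ dF).
  have := tmapE v (smooth_translate_right (b t)) aphi1 abpsi.
  by rewrite /F/= (chart_at_inv bphi2).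
have Er : tmap (translate_left (a t)) w psi =
    'd F (phi1 (a t), phi2 (b t)) (0, w phi2).
  rewrite -(diff_slicer _ dF).
  have := tmapE w (smooth_translate_left (a t)) bphi2 abpsi.
  by rewrite /F/= (chart_at_inv aphi1).
have -> : 'd F (phi1 (a t), phi2 (b t)) (v phi1, w phi2) =
    tmap (translate_right (b t)) v psi + tmap (translate_left (a t)) w psi.
  rewrite El Er -linearD; congr ('d F _ _).
  by congr pair; rewrite /= ?addr0 ?add0r.
apply: near_eq_is_derive.
have aN : \forall s \near t, chart_dom phi1 (a s).
  exact: ca _ (nbhs_chart_dom aphi1).
have bN : \forall s \near t, chart_dom phi2 (b s).
  exact: cb _ (nbhs_chart_dom bphi2).
apply: filterS2 aN bN => s as1 bs2.
by rewrite /F/= (chart_funK (c := phi1)) ?inE// (chart_funK (c := phi2)) ?inE.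
Qed.

End lie_group.

Lemma tmapZ (R : realType) (m n : nat) (M : manifoldType R m)
    (N : manifoldType R n) (f : M -> N) x (a : R) (v : tangent x) :
  smooth_map f -> tmap f (a *: v) = a *: tmap f v.
Proof.
move=> sf; have [phi xphi] := exists_chart_at x.
have [psi fpsi] := exists_chart_at (f x).
apply: (tangentP fpsi); rewrite tcoordZ.
have E1 := tmapE v sf xphi fpsi; have E2 := tmapE (a *: v) sf xphi fpsi.
by rewrite E2 E1 tcoordZ linearZ.
Qed.

Section lie_group.
Context {R : realType} {n : nat} {G : lieGroupType R n}.
Implicit Types (g h : G) (phi psi : chart R n G) (xi : lie_algebra G).

Lemma tmap_leftZ g (a : R) xi : tmap_left g (a *: xi) = a *: tmap_left g xi.
Proof.
have [phi phi1] := exists_chart_at (1%g : G).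
have [psi gpsi] := exists_chart_at g.
apply: (tangentP gpsi).
by rewrite tcoordZ !(tmap_leftE _ phi1 gpsi) tcoordZ linearZ.
Qed.

Lemma tmap_rightZ g (a : R) xi :
  tmap_right g (a *: xi) = a *: tmap_right g xi.
Proof.
have [phi phi1] := exists_chart_at (1%g : G).
have [psi gpsi] := exists_chart_at g.
apply: (tangentP gpsi).
by rewrite tcoordZ !(tmap_rightE _ phi1 gpsi) tcoordZ linearZ.
Qed.

Lemma tmap_left1 xi : tmap_left 1%g xi = xi.
Proof.
have [phi phi1] := exists_chart_at (1%g : G).
apply: (tangentP phi1); rewrite (tmap_leftE _ phi1 phi1).
have -> : translate_left 1%g = id :> (G -> G).
  by apply/funext => g; exact: mul1g.
exact: esym (tangent_change xi phi1 phi1).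
Qed.

(** Both sides are the differential at the unit of [k |-> g * k * h], bracketed in the two possible
    ways. *)
Lemma tmap_translateC g h xi :
  tmap (translate_right h) (tmap_left g xi) =
  tmap (translate_left g) (tmap_right h xi).
Proof.
have [psi ghpsi] := exists_chart_at (g * h)%g.
have [phi phi1] := exists_chart_at (1%g : G).
have [chi gchi] := exists_chart_at g.
have [rho hrho] := exists_chart_at h.
apply: (tangentP ghpsi).
have gchi1 : chart_at (translate_left g 1%g) chi.
  by rewrite /translate_left mulg1.
have hrho1 : chart_at (translate_right h 1%g) rho.
  by rewrite /translate_right mul1g.
have ghpsi1 : chart_at (translate_right h (translate_left g 1%g)) psi.
  by rewrite /translate_left mulg1.
have ghpsi2 : chart_at (translate_left g (translate_right h 1%g)) psi.
  by rewrite /translate_right mul1g.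
have L1 := tmapE (tmap_left g xi) (smooth_translate_right h) gchi ghpsi.
have L2 := tmapE (tmap_right h xi) (smooth_translate_left g) hrho ghpsi.
have E1 := diff_smooth_comp (xi phi) (smooth_translate_left g)
  (smooth_translate_right h) phi1 gchi1 ghpsi1.
have E2 := diff_smooth_comp (xi phi) (smooth_translate_right h)
  (smooth_translate_left g) phi1 hrho1 ghpsi2.
rewrite [translate_left g 1%g]mulg1 in E1.
rewrite [translate_right h 1%g]mul1g in E2.
rewrite (tmap_leftE xi phi1 gchi) in L1.
rewrite (tmap_rightE xi phi1 hrho) in L2.
have C : translate_right h \o translate_left g =
    translate_left g \o translate_right h :> (G -> G).
  by apply/funext => k; exact: esym (mulgA g k h).
rewrite C in E1.
exact: etrans L1 (etrans (esym E1) (etrans E2 (esym L2))).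
Qed.

(** The velocity of [gamma s * delta (T - s)] is a difference of the two sides of [tmap_translateC],
    hence zero. Only continuity is asked at the endpoints, since a parallel transport has just
    one-sided velocities there. *)
Lemma left_right_integral xi (gamma delta : R -> G) (T : R) : 0 <= T ->
  (forall t, t \in `[0, T] ->
    gamma s @[s --> within `[0, T]%classic (nbhs t)] --> gamma t) ->
  (forall t, t \in `[0, T] ->
    delta s @[s --> within `[0, T]%classic (nbhs t)] --> delta t) ->
  (forall t, t \in `]0, T[ -> has_velocity (tmap_left (gamma t) xi)) ->
  (forall t, t \in `]0, T[ -> has_velocity (tmap_right (delta t) xi)) ->
  (gamma T * delta 0 = gamma 0 * delta T)%g.
Proof.
move=> T0 cg cd dg dd.
(* The shape [-1 * t + T] is the one that [has_velocity_affine] expects. *)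
have revT (t : R) : -1 * t + T = T - t by rewrite mulN1r addrC.
have rev_itv (b1 b2 : bool) (t : R) :
    (-1 * t + T \in Interval (BSide b1 0) (BSide b2 T)) =
    (t \in Interval (BSide (~~ b2) 0) (BSide (~~ b1) T)).
  rewrite revT !in_itv/=; case: b1; case: b2;
  by rewrite /= ?subr_ge0 ?subr_gt0 ?gerBl ?gtrBl andbC.
have -> : (gamma T * delta 0 = gamma T * delta (-1 * T + T))%g.
  by rewrite revT subrr.
have -> : (gamma 0 * delta T = gamma 0 * delta (-1 * 0 + T))%g.
  by rewrite revT subr0.
apply/esym.
apply: (@eq_of_velocity0 _ _ _
  (fun s => gamma s * delta (-1 * s + T))%g) => // t tT.
  have rtT : -1 * t + T \in `[0, T] by rewrite rev_itv.
  have crev : (-1 * s + T) @[s --> within `[0, T]%classic (nbhs t)] -->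
      within `[0, T]%classic (nbhs (-1 * t + T)).
    move=> A; rewrite /within/= => nA.
    have cr : {for t, continuous (fun s : R => -1 * s + T)}.
      by apply: cvgD; [apply: cvgMr; exact: cvg_id|exact: cvg_cst].
    apply: (@filterS _ (nbhs t) _ _ _ _ (cr _ nA)) => s /= As sT; apply: As.
    by rewrite /= rev_itv.
  apply: (@cvg_comp _ _ _ (fun s => (gamma s, delta (-1 * s + T)))
    (fun p : G * G => (p.1 * p.2)%g) _ _ _ _
    (mulg_continuous (gamma t, delta (-1 * t + T)))).
  apply: cvg_pair => /=; first exact: cg.
  exact: cvg_comp crev (cd _ rtT).
have rtT : -1 * t + T \in `]0, T[ by rewrite rev_itv.
have := has_velocity_mulg (dg t tT) (has_velocity_affine (dd _ rtT)).
rewrite tmapZ ?tmap_translateC ?scaleN1r ?subrr//.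
exact: smooth_translate_left.
Qed.

End lie_group.

(** * Local existence of integral curves *)

(** The equation is solved for the coordinate field [X]; the solution stays in a ball inside
    [chart_cod phi], so [chart_inv phi] carries it to the manifold. *)
Lemma integral_curve_exists (R : realType) (n : nat) (M : manifoldType R n)
    (v : forall x : M, tangent x) (x0 : M) (phi : chart R n M)
    (X : 'rV[R]_n -> 'rV[R]_n) :
  chart_at x0 phi -> Ck 1 (chart_cod phi) X ->
  (forall u, chart_cod phi u -> v (chart_inv phi u) phi = X u) ->
  exists (eps : R) (gamma : R -> M), [/\ 0 < eps, gamma 0 = x0 &
    forall t, t \in `](- eps), eps[ -> has_velocity (v (gamma t))].
Proof.
move=> xphi cX vX.
have [r [K [r0 K0 rU XK]]] := Ck1_locally_lipschitz (nbhs_chart_cod xphi) cX.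
have [eps [c [eps0 c0 cP]]] := picard_lipschitz r0 K0 XK.
exists eps, (chart_inv phi \o c); split => //.
  by rewrite /= c0 chart_at_inv.
move=> t te; have [cr dc] := cP t te.
have cU := rU _ cr.
have gphi : chart_at (chart_inv phi (c t)) phi.
  by split; [case: xphi|exact: chart_invS].
have cct : {for t, continuous c} by exact: is_derive_continuous dc.
apply: (has_velocity_chart (phi := phi)) => //.
  apply: continuous_comp => //; apply: chart_inv_continuous.
  by rewrite inE.
rewrite /= vX//; apply: near_eq_is_derive dc.
have := near_in_itvoo te; apply: filterS => s se /=.
by have [sr _] := cP s se; rewrite (chart_invK (c := phi))// inE; exact: rU.
Qed.

Section local_integral_curves.
Context {R : realType} {n : nat} {G : lieGroupType R n}.
Variables (xi : lie_algebra G) (phi : chart R n G).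
Hypothesis phi1 : chart_at 1%g phi.

Let F (u : 'rV[R]_n * 'rV[R]_n) : 'rV[R]_n :=
  phi (chart_inv phi u.1 * chart_inv phi u.2)%g.
Let U := [set u : 'rV[R]_n * 'rV[R]_n |
  [/\ chart_cod phi u.1, chart_cod phi u.2 &
      chart_dom phi (chart_inv phi u.1 * chart_inv phi u.2)%g]].

Let Ul u : U (u, phi 1%g) = chart_cod phi u.
Proof.
apply/propext; split=> [[]//|uphi]; split => //=; first exact: chart_at_cod.
by rewrite chart_at_inv// mulg1; exact: chart_invS.
Qed.

Let Ur u : U (phi 1%g, u) = chart_cod phi u.
Proof.
apply/propext; split=> [[]//|uphi]; split => //=; first exact: chart_at_cod.
by rewrite chart_at_inv// mul1g; exact: chart_invS.
Qed.

Let dF u : U u -> differentiable F u.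
Proof.
have [+ _] := mulg_smooth _ _ _ phi1.1 phi1.1 phi1.1 1%N.
by move=> + Uu; apply; rewrite inE.
Qed.

(** The invariant fields are directional derivatives of the multiplication, so the Lipschitz bound
    for them takes two orders of differentiability. *)
Let CF w : Ck 1 U ('D_w F).
Proof. by have [_] := mulg_smooth _ _ _ phi1.1 phi1.1 phi1.1 2%N; exact. Qed.

Let chart_at_inv_cod u : chart_cod phi u -> chart_at (chart_inv phi u) phi.
Proof. by move=> uphi; split; [case: phi1|exact: chart_invS]. Qed.

(** In coordinates the left-invariant field at [u] is the derivative of the multiplication at
    [(u, phi 1)] in the direction [(0, xi phi)], a field of class C^1. *)
Lemma left_integral_exists : exists (eps : R) (gamma : R -> G),
  [/\ 0 < eps, gamma 0 = 1%g & forall t, t \in `](- eps), eps[ ->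
      has_velocity (tmap_left (gamma t) xi)].
Proof.
apply: (integral_curve_exists (v := fun g => tmap_left g xi)
  (X := fun u => 'D_(0, xi phi) F (u, phi 1%g)) phi1).
  have := Ck_slicel (phi 1%g) (CF (0, xi phi)).
  by under [X in Ck _ X]eq_set do rewrite Ul.
move=> u uphi; rewrite (tmap_leftE xi phi1 (chart_at_inv_cod uphi)).
have dFu : differentiable F (u, phi 1%g) by apply: dF; rewrite Ul.
exact: etrans (diff_slicer (xi phi) dFu) (esym (deriveE _ dFu)).
Qed.

Lemma right_integral_exists : exists (eps : R) (delta : R -> G),
  [/\ 0 < eps, delta 0 = 1%g & forall t, t \in `](- eps), eps[ ->
      has_velocity (tmap_right (delta t) xi)].
Proof.
apply: (integral_curve_exists (v := fun g => tmap_right g xi)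
  (X := fun u => 'D_(xi phi, 0) F (phi 1%g, u)) phi1).
  have := Ck_slicer (phi 1%g) (CF (xi phi, 0)).
  by under [X in Ck _ X]eq_set do rewrite Ur.
move=> u uphi; rewrite (tmap_rightE xi phi1 (chart_at_inv_cod uphi)).
have dFu : differentiable F (phi 1%g, u) by apply: dF; rewrite Ur.
exact: etrans (diff_slicel (xi phi) dFu) (esym (deriveE _ dFu)).
Qed.

End local_integral_curves.

(** * One-sided and two-sided velocities *)

Lemma has_velocity_within (R : realType) (n : nat) (M : manifoldType R n)
    (I : set R) (gamma : R -> M) (t : R) (v : tangent (gamma t)) :
  has_velocity v -> velocity_within I gamma t v.
Proof.
move=> [cg dg]; split.
  by apply: (cvg_trans _ cg); apply: cvg_fmap2; exact: cvg_within.
move=> phi gphi; have /is_derive_quotient H := dg phi gphi.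
by apply: (cvg_trans _ H); apply: cvg_fmap2; exact: cvg_within.
Qed.

Lemma within_nbhs_cvg (T U : Type) (F : set_system T) (A : set T)
    (f : T -> U) (G : set_system U) : Filter F -> F A ->
  f s @[s --> within A F] --> G -> f s @[s --> F] --> G.
Proof.
move=> FF FA fG B GB; have := fG B GB => /= wB.
apply: (@filterS2 _ F _ _ _ _ _ FA wB) => s As; exact.
Qed.

Lemma near0_shift_in (R : realType) (I : set R) (t : R) : nbhs t I ->
  \forall h \near 0^', I (t + h).
Proof.
move=> tI; apply: cvg_within.
have c : {for (0 : R), continuous (fun h : R => t + h)}.
  by apply: cvgD; [exact: cvg_cst|exact: cvg_id].
by apply: (c I); rewrite /= addr0.
Qed.

Lemma velocity_within_interior (R : realType) (n : nat) (M : manifoldType R n)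
    (I : set R) (gamma : R -> M) (t : R) (v : tangent (gamma t)) :
  nbhs t I -> velocity_within I gamma t v -> has_velocity v.
Proof.
move=> tI [cg dg]; split; first exact: within_nbhs_cvg tI cg.
move=> phi gphi; apply/is_derive_quotient.
exact: within_nbhs_cvg (near0_shift_in tI) (dg phi gphi).
Qed.

(** A whole field [v] is taken because vectors at [gamma t] and at [delta t] have different types
    even when the points are equal. *)
Lemma velocity_within_eq (R : realType) (n : nat) (M : manifoldType R n)
    (I : set R) (gamma delta : R -> M) (v : forall x : M, tangent x) (t : R) :
  I t -> (forall s, I s -> gamma s = delta s) ->
  velocity_within I delta t (v (delta t)) ->
  velocity_within I gamma t (v (gamma t)).
Proof.
move=> It gd [cd dd]; split.
  rewrite gd//; apply: cvg_trans cd; apply: near_eq_cvg.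
  by apply: filterS (near_withinT I _) => s /gd.
move=> phi; rewrite gd// => /dd; apply: cvg_trans; apply: near_eq_cvg.
by apply: filterS (near_withinT [set h | I (t + h)] _) => h /= /gd ->.
Qed.

(** * Local one-parameter subgroups *)

Section one_parameter.
Context {R : realType} {n : nat} {G : lieGroupType R n}.
Implicit Types (xi : lie_algebra G).

(** A time shift of the left integral curve [gamma] is again one; comparing it with the right
    integral curve [delta] gives [gamma (t + s) = gamma t * delta s] for [s >= 0]. At [t = 0] this
    identifies [delta] with [gamma] for nonnegative times. *)
Lemma local_one_parameter xi : exists (eps : R) (gamma : R -> G),
  [/\ 0 < eps, gamma 0 = 1%g, has_velocity (tmap_left (gamma 0) xi) &
    forall s t, `|s| < eps -> `|t| < eps ->
      gamma (s + t) = (gamma s * gamma t)%g].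
Proof.
have [phi phi1] := exists_chart_at (1%g : G).
have [e1 [gamma [e10 g0 dg]]] := left_integral_exists xi phi1.
have [e2 [delta [e20 d0 dd]]] := right_integral_exists xi phi1.
pose d := Num.min e1 e2.
have d_gt0 : 0 < d by rewrite lt_min e10.
have {}dg (t : R) : t \in `](- d), d[ -> has_velocity (tmap_left (gamma t) xi).
  rewrite !in_itv/= -ltr_norml lt_min => /andP[t1 _].
  by apply: dg; rewrite in_itv/= -ltr_norml.
have {}dd (t : R) : t \in `](- d), d[ -> has_velocity (tmap_right (delta t) xi).
  rewrite !in_itv/= -ltr_norml lt_min => /andP[_ t2].
  by apply: dd; rewrite in_itv/= -ltr_norml.
have gd (s t : R) : t \in `](- d), d[ -> 0 <= s -> s < d -> t + s < d ->
    gamma (t + s) = (gamma t * delta s)%g.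
  rewrite in_itv/= => /andP[td1 td2] s0 sd ts.
  have sub (x : R) : x \in `[0, s] -> 1 * x + t \in `](- d), d[.
    rewrite !in_itv/= mul1r => /andP[x0 xs].
    rewrite (lt_le_trans td1) ?lerDr//= addrC (le_lt_trans _ ts)//.
    by rewrite lerD2l.
  have subd (x : R) : x \in `[0, s] -> x \in `](- d), d[.
    rewrite !in_itv/= => /andP[x0 xs].
    by rewrite (lt_le_trans _ x0) ?oppr_lt0//= (le_lt_trans xs).
  have dgt (x : R) : x \in `[0, s] ->
      @has_velocity _ _ _ (fun y => gamma (1 * y + t)) x
        (tmap_left (gamma (1 * x + t)) xi).
    move=> xs; have := has_velocity_affine (dg _ (sub x xs)).
    by rewrite scale1r.
  have dds (x : R) : x \in `[0, s] -> has_velocity (tmap_right (delta x) xi).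
    by move=> xs; exact: dd (subd x xs).
  have := left_right_integral (xi := xi) (gamma := fun y => gamma (1 * y + t))
    (delta := delta) s0.
  rewrite d0 mulg1 mul1r mulr0 add0r [s + t]addrC; apply.
  - by move=> x /dgt/(has_velocity_within `[0, s]%classic)[].
  - by move=> x /dds/(has_velocity_within `[0, s]%classic)[].
  - by move=> x /subset_itv_oo_cc; exact: dgt.
  - by move=> x /subset_itv_oo_cc; exact: dds.
have zd : (0 : R) \in `](- d), d[ by rewrite in_itv/= oppr_lt0 d_gt0.
have dE (s : R) : 0 <= s -> s < d -> delta s = gamma s.
  by move=> s0 sd; rewrite -[in RHS](add0r s) gd ?add0r// g0 mul1g.
have ge (s t : R) : t \in `](- d), d[ -> 0 <= s -> s < d -> t + s < d ->
    gamma (t + s) = (gamma t * gamma s)%g.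
  by move=> td s0 sd ts; rewrite gd// dE.
have gN (s : R) : 0 <= s -> s < d -> gamma (- s) = (gamma s)^-1%g.
  move=> s0 sd; have sd' : - s \in `](- d), d[.
    by rewrite in_itv/= ltrN2 sd (le_lt_trans _ d_gt0)// oppr_le0.
  have := ge s (- s) sd' s0 sd; rewrite addNr g0 => /(_ d_gt0) E.
  by apply: (@mulIg _ (gamma s)); rewrite -E mulVg.
(* Halving [d] keeps [s + t] inside []-d, d[]. *)
exists (d / 2), gamma; split; [by rewrite divr_gt0|by []|exact: dg|].
move=> s t; rewrite !ltr_norml => /andP[s1 s2] /andP[t1 t2].
have [t0|t0] := leP 0 t.
  by apply: ge; rewrite ?in_itv//=; lra.
have tt : - t < d by lra.
have nt : 0 <= - t by lra.
(* For negative [t], the rule already known is applied to [s = (s + t) + (- t)], and [gamma (- t)]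
   is moved across as an inverse. *)
have std : s + t \in `](- d), d[ by rewrite in_itv/=; lra.
have stt : (s + t) + - t < d by lra.
have := ge (- t) (s + t) std nt tt stt.
rewrite addrK => ->; rewrite -mulgA.
have -> : gamma t = (gamma (- t))^-1%g by rewrite -gN// opprK.
by rewrite mulgV mulg1.
Qed.

End one_parameter.

(** * One-parameter subgroups and the exponential map *)

Section one_parameter_extension.
Context {R : realType} {G : groupType} (eps : R) (gamma : R -> G).
Hypothesis eps0 : 0 < eps.
Hypothesis gammaD : forall s t, `|s| < eps -> `|t| < eps ->
  gamma (s + t) = (gamma s * gamma t)%g.

Let gamma0 : gamma 0 = 1%g.
Proof.
by apply: (@mulgI _ (gamma 0)); rewrite -gammaD ?normr0// addr0 mulg1.
Qed.

Let gammaX k (x : R) : `|x *+ k| < eps -> gamma (x *+ k) = (gamma x ^+ k)%g.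
Proof.
elim: k => [|k IH]; first by rewrite mulr0n gamma0.
rewrite normrMn => xk.
have xk' : `|x *+ k| < eps.
  by rewrite normrMn (le_lt_trans _ xk)// ler_wpMn2l.
have x1 : `|x| < eps by rewrite (le_lt_trans _ xk)// mulrS lerDl mulrn_wge0.
by rewrite mulrS gammaD// IH// expgS.
Qed.

Let small (N : nat) (t : R) := (0 < N)%N && (`|t / N%:R| < eps).

(** Both powers equal the one obtained from the common refinement of [t] into [N * M] steps. *)
Let smallE N M t : small N t -> small M t ->
  (gamma (t / N%:R) ^+ N = gamma (t / M%:R) ^+ M)%g.
Proof.
have key A B : small A t -> (0 < B)%N ->
    (gamma (t / A%:R) = gamma (t / (A * B)%:R) ^+ B)%g.
  move=> /andP[A0 tA] B0.
  have E : t / A%:R = (t / (A * B)%:R) *+ B.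
    rewrite -[RHS]mulr_natr natrM; field.
    by rewrite !pnatr_eq0 -!lt0n A0 B0.
  by rewrite E gammaX// -E.
move=> tN tM; have /andP[N0 _] := tN; have /andP[M0 _] := tM.
by rewrite (key N M)// (key M N)// -!expgnA mulnC [(M * N)%N]mulnC.
Qed.

Let small_le N M t : (N <= M)%N -> small N t -> small M t.
Proof.
move=> NM /andP[N0 tN]; have M0 := leq_trans N0 NM; rewrite /small M0/=.
apply: le_lt_trans tN; rewrite !normrM ler_wpM2l// !normfV.
by rewrite lef_pV2 ?posrE ?normr_gt0 ?pnatr_eq0 -?lt0n// !normr_nat ler_nat.
Qed.

Let N_ (t : R) : nat := (Num.bound (`|t| / eps)).+1.

Let small_N t : small (N_ t) t.
Proof.
rewrite /small/= normrM normfV normr_nat ltr_pdivrMr ?ltr0n//.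
rewrite mulrC -ltr_pdivrMr//.
have te : 0 <= `|t| / eps by rewrite divr_ge0// ltW.
by rewrite (lt_trans (archi_boundP te))// ltr_nat.
Qed.

(** The extension at [t] is [gamma (t / N) ^+ N] for any [N] large enough; a common number of steps
    for [s], [t] and [s + t] gives additivity. *)
Lemma one_parameter_extension : exists Gamma : R -> G,
  (forall s t, Gamma (s + t) = (Gamma s * Gamma t)%g) /\
  forall t, `|t| < eps -> Gamma t = gamma t.
Proof.
exists (fun t => gamma (t / (N_ t)%:R) ^+ N_ t)%g; split; last first.
  move=> t te; have t1 : small 1 t by rewrite /small/= divr1.
  by rewrite (smallE (small_N t) t1) divr1 expg1.
move=> s t; pose K := (N_ s + N_ t + N_ (s + t))%N.
have sK : small K s by apply: small_le (small_N s); rewrite /K -addnA leq_addr.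
have tK : small K t.
  by apply: small_le (small_N t); rewrite /K addnAC leq_addl.
have stK : small K (s + t) by apply: small_le (small_N _); rewrite leq_addl.
rewrite (smallE (small_N _) stK) (smallE (small_N _) sK).
rewrite (smallE (small_N _) tK).
have /andP[_ s1] := sK; have /andP[_ t1] := tK.
(* The factors [gamma (s / K)] and [gamma (t / K)] commute because either product is [gamma] of the
   sum of the arguments. *)
rewrite mulrDl gammaD// expgMn// /commute.
by rewrite -!gammaD// addrC.
Qed.

End one_parameter_extension.

Section one_parameter.
Context {R : realType} {n : nat} {G : lieGroupType R n}.
Implicit Types (xi : lie_algebra G) (Gamma : R -> G).

(* [Gamma] is [L_(Gamma t)], and also [R_(Gamma t)], applied to its translate *)
(* [s |-> Gamma (s - t)], which passes through the unit at time [t].          *)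
Lemma one_parameter_velocity xi Gamma (t : R) :
  (forall s u, Gamma (s + u) = (Gamma s * Gamma u)%g) ->
  has_velocity (tmap_left (Gamma 0) xi) ->
  has_velocity (tmap_left (Gamma t) xi) /\
  has_velocity (tmap_right (Gamma t) xi).
Proof.
move=> GD; have G0 : Gamma 0 = 1%g.
  by apply: (@mulgI _ (Gamma 0)); rewrite -GD addr0 mulg1.
move=> [cG dG].
have [phi phi1] := exists_chart_at (1%g : G).
have {}dG : is_derive (0 : R) 1 (phi \o Gamma) (xi phi).
  have := dG phi; rewrite G0 => /(_ phi1).
  by rewrite tmap_left1.
pose c (s : R) : G := Gamma (1 * s + - t).
have tt : 1 * t + - t = 0 :> R by rewrite mul1r subrr.
have ct : c t = 1%g by rewrite /c tt.
have cc : {for t, continuous c}.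
  apply: (@continuous_comp _ _ _ (fun s : R => 1 * s + - t) Gamma) => /=.
    by apply: cvgD; [apply: cvgMr; exact: cvg_id|exact: cvg_cst].
  by rewrite tt.
have dc : is_derive t 1 (phi \o c) (xi phi).
  rewrite -[xi phi]scale1r.
  by apply: (@is_derive_affine _ _ (phi \o Gamma)); rewrite tt.
have cphi : chart_at (c t) phi by rewrite ct.
have key (f : G -> G) (v : tangent (Gamma t)) (psi : chart R n G) :
    smooth_map f -> f \o c = Gamma -> chart_at (Gamma t) psi ->
    v psi = 'd (psi \o f \o chart_inv phi) (phi 1%g) (xi phi) ->
    has_velocity v.
  move=> sf fc Gpsi vE; apply: (has_velocity_chart (phi := psi)) => //.
    by rewrite -fc; apply: continuous_comp => //; exact: sf.1.
  have fpsi : chart_at (f (c t)) psi.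
    by rewrite -[f (c t)]/((f \o c) t) fc.
  have := is_derive_smooth sf cc cphi fpsi dc.
  by rewrite fc ct -vE.
have [psi Gpsi] := exists_chart_at (Gamma t).
split.
  apply: (key (translate_left (Gamma t)) _ psi) => //.
  - exact: smooth_translate_left.
  - by apply/funext => s; rewrite /= /translate_left /c -GD mul1r subrKC.
  - exact: tmap_leftE.
apply: (key (translate_right (Gamma t)) _ psi) => //.
- exact: smooth_translate_right.
- by apply/funext => s; rewrite /= /translate_right /c -GD mul1r subrK.
- exact: tmap_rightE.
Qed.

Lemma one_parameter_exists xi : exists Gamma,
  [/\ Gamma 0 = 1%g, forall t, has_velocity (tmap_left (Gamma t) xi) &
      forall t, has_velocity (tmap_right (Gamma t) xi)].
Proof.
have [eps [gamma [eps0 g0 dg gD]]] := local_one_parameter xi.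
have [Gamma [GD Gg]] := one_parameter_extension eps0 gD.
have G0 : Gamma 0 = 1%g by rewrite Gg ?normr0.
(* Velocity at 0 depends only on the germ, so [Gamma] inherits it from [gamma]. *)
have GgN : \forall s \near (0 : R), gamma s = Gamma s.
  have := @near_in_itvoo R (- eps) eps 0.
  rewrite in_itv/= oppr_lt0 eps0 => /(_ isT); apply: filterS => s.
  by rewrite in_itv/= -ltr_norml => /Gg.
have dG : has_velocity (tmap_left (Gamma 0) xi).
  move: dg; rewrite /has_velocity G0 g0 => -[cg dg]; split.
    rewrite /prop_for /continuous_at G0 -g0; apply: cvg_trans cg.
    exact: near_eq_cvg GgN.
  move=> phi phi1; have := dg phi phi1; apply: near_eq_is_derive.
  by apply: filterS GgN => s /= ->.
exists Gamma; split => // t;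
  by have [] := one_parameter_velocity t GD dG.
Qed.

(** The rescaled curve [t |-> Gamma (s * t)] solves both equations for [s *: xi]. As a left integral
    curve it shows that the default value is not taken; as a right one it forces any left integral
    curve from the unit to end at [Gamma s]. *)
Lemma lie_exp_one_parameter xi Gamma (s : R) : Gamma 0 = 1%g ->
  (forall t, has_velocity (tmap_left (Gamma t) xi)) ->
  (forall t, has_velocity (tmap_right (Gamma t) xi)) ->
  lie_exp (s *: xi) = Gamma s.
Proof.
move=> G0 dl dr; pose Gs (t : R) : G := Gamma (s * t + 0).
have Gs0 : Gs 0 = 1%g by rewrite /Gs mulr0 addr0.
have Gs1 : Gs 1 = Gamma s by rewrite /Gs mulr1 addr0.
have dls (t : R) : has_velocity (tmap_left (Gs t) (s *: xi)).
  by rewrite tmap_leftZ; exact: has_velocity_affine (dl _).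
have drs (t : R) : has_velocity (tmap_right (Gs t) (s *: xi)).
  by rewrite tmap_rightZ; exact: has_velocity_affine (dr _).
rewrite /lie_exp; case: xgetP => [g -> [gamma [g0 dg <-]]|]; last first.
  move=> /(_ (Gamma s)) []; exists Gs; split => // t.
  exact: has_velocity_within (dls t).
have {}dg (t : R) : has_velocity (tmap_left (gamma t) (s *: xi)).
  by apply: velocity_within_interior (dg t); exact: filterT.
have := left_right_integral (xi := s *: xi) (gamma := gamma) (delta := Gs)
  (ler01 : 0 <= 1 :> R).
rewrite g0 Gs0 Gs1 mulg1 mul1g; apply.
- by move=> t _; have [] := has_velocity_within `[0, 1]%classic (dg t).
- by move=> t _; have [] := has_velocity_within `[0, 1]%classic (drs t).
- by move=> t _; exact: dg.
- by move=> t _; exact: drs.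
Qed.

End one_parameter.

(** * Derivatives in the Lie algebra and parallel transport *)

Lemma derivative_within_line (R : realType) (n : nat) (M : manifoldType R n)
    (x : M) (I : set R) (v : tangent x) (t : R) :
  derivative_within I (fun s => s *: v) t v.
Proof.
move=> phi xphi; have E : \forall h \near within [set h | I (t + h)] 0^',
    v phi = h^-1 *: (((t + h) *: v) phi - (t *: v) phi).
  apply: cvg_within; apply: filterS (nbhs_dnbhs_neq (0 : R)) => h h0.
  by rewrite !tcoordZ -scalerBl addrAC subrr add0r scalerA mulVf ?scale1r.
by apply: (cvg_trans (near_eq_cvg E)); exact: cvg_cst.
Qed.

Lemma derivative_within_unique (R : realType) (n : nat) (M : manifoldType R n)
    (x : M) (I : set R) (c : R -> tangent x) (t : R) (v w : tangent x) :
  nbhs t I -> derivative_within I c t v -> derivative_within I c t w -> v = w.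
Proof.
move=> tI dv dw; have [phi xphi] := exists_chart_at x.
apply: (tangentP xphi).
have cvg_in (u : tangent x) : derivative_within I c t u ->
    h^-1 *: (c (t + h) phi - c t phi) @[h --> 0^'] --> u phi.
  by move=> du; exact: within_nbhs_cvg (near0_shift_in tI) (du phi xphi).
exact: cvg_unique (cvg_in v dv) (cvg_in w dw).
Qed.

Theorem theorem7 (R : realType) (n : nat) (G : lieGroupType R n)
    (xi : lie_algebra G) (g : R -> G) :
  parallel_transport natural_connection (fun t => t *: xi) g <->
  (forall t : R, t \in `[0, 1] -> g t = lie_exp (t *: xi)).
Proof.
have [Gamma [G0 dl dr]] := one_parameter_exists xi.
have expE t : lie_exp (t *: xi) = Gamma t by exact: lie_exp_one_parameter.
split=> [[lift g0] t t01|gE].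
  have sub (s : R) : s \in `[0, t] -> s \in `[0, 1].
    move: t01; rewrite !in_itv/= => /andP[_ t1] /andP[-> st].
    exact: le_trans st t1.
  have t0 : 0 <= t by move: t01; rewrite in_itv/= => /andP[].
  rewrite expE.
  (* The comparison runs on [[0, t]], in whose interior the one-sided velocities of [g] are ordinary
     ones. *)
  have := left_right_integral (xi := xi) (gamma := Gamma) (delta := g) t0.
  rewrite g0 mulg1 G0 mul1g => H; apply/esym/H.
  - by move=> s _; have [] := has_velocity_within `[0, t]%classic (dl s).
  - move=> s st; have [_ [u [_ [cg _] _]]] := lift s (sub s st).
    by apply: within_cvg_subset cg => r; exact: sub.
  - by move=> s _; exact: dl.
  - move=> s st; have s01 : nbhs s `[0, 1]%classic.
      apply: filterS (near_in_itvoo st) => r /subset_itv_oo_cc.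
      exact: sub.
    have [_ [u [du vu [v _ uE]]]] := lift s (sub s (subset_itv_oo_cc st)).
    move: du vu; rewrite -uE /= => dv vu.
    (* Horizontality gives the velocity of [g] as the right translate of some [v]; uniqueness of the
       derivative of [r *: xi] forces [v = xi]. *)
    have vxi : v = xi.
      apply: (derivative_within_unique (c := fun r => r *: xi) s01 dv).
      exact: derivative_within_line.
    by rewrite vxi in vu; exact: velocity_within_interior s01 vu.
(* Outside [[0, 1]] nothing is known about [g], so the velocity of [Gamma] is transferred within
   that interval only. *)
have gG s : `[0, 1]%classic s -> g s = Gamma s by move=> /gE ->.
split; last by rewrite gG//= in_itv/= lexx ler01.
move=> t t01; split => //; exists (xi, tmap_right (g t) xi); split => /=.
- exact: derivative_within_line.
- apply: (velocity_within_eq (v := fun x => tmap_right x xi) t01 gG).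
  exact: has_velocity_within (dr t).
- by exists xi.
Qed.
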